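(* Let $G$ be a Borel prefix-independent game played on a finite graph, let $\lambda$ be a requirement, $i\in\Pi$ and $v_0\in V_i$, and let $s_0=(v_0,\{v_0\})$. Then $\mathsf{val}_{\mathbb{C}}(\mathsf{Conc}_{\lambda i}(G)_{\|s_0})=\mathsf{nego}(\lambda)(v_0)$. Moreover, if for every player $i$ and every $v_0\in V_i$ Prover has an optimal strategy in $\mathsf{Conc}_{\lambda i}(G)_{\|(v_0,\{v_0\})}$ for every requirement $\lambda$, then $G$ has steady negotiation.
   Context: A game is a tuple $G=(\Pi,V,(V_i)_{i\in\Pi},E,\mu)$ with finite player set $\Pi$, directed graph $(V,E)$ in which every vertex has an outgoing edge, partition $(V_i)$ of $V$ ($V_i$ = vertices of player $i$), and payoff $\mu:V^\omega\to\mathbb{R}^\Pi$; it is Borel if $\mu$ is Borel for the product topology, and prefix-independent if $\mu(h\rho)=\mu(\rho)$ for every history $h$ and play $\rho$ with $h\rho$ a play. Strategies, profiles, outcomes $\langle\bar\sigma\rangle$, $\bar\sigma_{\|hv}$ (profile from $v$ with $\sigma_{j\|hv}(h')=\sigma_j(hh')$) are as usual; $-i=\Pi\setminus\{i\}$. A requirement is $\lambda:V\to\overline{\mathbb{R}}$. A play $\rho$ is $\lambda$-consistent if for all $j$, $n$ with $\rho_n\in V_j$, $\mu_j(\rho_{\ge n})\ge\lambda(\rho_n)$. For $v\in V_i$, $\bar\sigma_{-i}$ from $v$ is $\lambda$-rational if some $\sigma_i$ makes $\langle\bar\sigma_{\|hu}\rangle$ $\lambda$-consistent for every history $hu$ from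 $v$ compatible with $\bar\sigma_{-i}$; $\lambda\mathsf{Rat}(v)$ is the set of such profiles; $\mathsf{nego}(\lambda)(v)=\inf_{\bar\sigma_{-i}\in\lambda\mathsf{Rat}(v)}\sup_{\sigma_i}\mu_i(\langle\bar\sigma_{-i},\sigma_i\rangle)$ with $\inf\emptyset=+\infty$. $G$ has steady negotiation if for all $\lambda$, $i$, $v\in V_i$ with $\lambda\mathsf{Rat}(v)\ne\emptyset$ this infimum is attained. The concrete negotiation game $\mathsf{Conc}_{\lambda i}(G)$ is the two-player zero-sum game between Prover ($\mathbb{P}$) and Challenger ($\mathbb{C}$) with Prover's states $V\times2^V$ and Challenger's states $E\times2^V$, and transitions: proposals $(v,M)\to(vw,M)$ for $vw\in E$; acceptations $(vw,M)\to(w,M\cup\{w\})$; deviations $(uv,M)\to(w,\{w\})$ whenever $u\in V_i$, $uw\in E$ and $w\ne v$. For a play $\pi=(h_0,M_0)(h_0h'_0,M_0)(h_1,M_1)\cdots$ its projection is the play $\dot\pi=h_0h_1h_2\cdots$ of $G$ (the vertex components of Prover's states); $\dot\pi_{\ge n}$ denotes the projection's suffix from index $n$, i.e. the projection of $\pi_{\ge2n}$. Challenger's payoff $\nu_{\mathbb{C}}=-\nu_{\mathbb{P}}$ is $\nu_{\mathbb{C}}(\pi)=+\infty$ if there is $n$ such that $\pi_{\ge2n}$ uses no deviation transition and $\dot\pi_{\ge n}$ is not $\lambda$-consistent, and $\nu_{\mathbb{C}}(\pi)=\mu_i(\dot\pi)$ otherwise. $\mathsf{val}_{\mathbb{C}}$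 is the value for Challenger ($\sup_{\tau_{\mathbb{C}}}\inf_{\tau_{\mathbb{P}}}\nu_{\mathbb{C}}=\inf_{\tau_{\mathbb{P}}}\sup_{\tau_{\mathbb{C}}}\nu_{\mathbb{C}}$); a Prover strategy $\tau_{\mathbb{P}}$ is optimal if $\sup_{\tau_{\mathbb{C}}}\nu_{\mathbb{C}}(\langle\tau_{\mathbb{P}},\tau_{\mathbb{C}}\rangle)$ equals that value. *)

(* Defs.v *)
From HB Require Import structures.
From mathcomp Require Import all_boot all_order all_algebra.
From mathcomp Require Import all_classical all_reals all_analysis.
From mathcomp Require Import Rstruct Rstruct_topology.

Set Implicit Arguments.
Unset Strict Implicit.
Unset Printing Implicit Defensive.

Import Order.TTheory GRing.Theory Num.Theory numFieldNormedType.Exports.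
Local Open Scope classical_set_scope.
Local Open Scope ereal_scope.

(* A game is given by a finite player type Pi, a finite vertex type V, *)
(* an edge relation E (every vertex has a successor: hypothesis of the *)
(* theorem), an owner map (the partition (V_i)), and a payoff          *)
(* mu : V^omega -> R^Pi.                                               *)
(* Histories are non-empty sequences v :: t with path E v t.           *)
(* Strategies are total functions seq V -> V; only their values on     *)
(* relevant histories matter (validity is required there).            *)

Section Game.
Variables (R : realType) (Pi V : finType) (E : rel V) (owner : V -> Pi)
  (mu : (nat -> V) -> Pi -> R).

Definition is_play (rho : nat -> V) : Prop := forall n, E (rho n) (rho n.+1).

Definition prepend (h : seq V) (rho : nat -> V) : nat -> V :=
  fun n => if (n < size h)%N then nth (rho 0%N) h n else rho (n - size h)%N.

Definition prefix_independent : Prop :=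
  forall (h : seq V) (rho : nat -> V),
    is_play rho -> is_play (prepend h rho) -> mu (prepend h rho) = mu rho.

(* open sets of V^omega for the product topology (V discrete) *)
Definition seq_open (U : set (nat -> V)) : Prop :=
  forall rho, U rho -> exists n, forall rho',
      (forall k, (k < n)%N -> rho' k = rho k) -> U rho'.

Definition seq_borel (A : set (nat -> V)) : Prop := <<s seq_open >> A.

Definition borel_payoff : Prop :=
  forall (j : Pi) (U : set R), open U -> seq_borel ((fun rho => mu rho j) @^-1` U).

Definition strategy := seq V -> V.
Definition profile := Pi -> strategy.

Definition strat_from (j : Pi) (v : V) (s : strategy) : Prop :=
  forall t, path E v t -> owner (last v t) = j -> E (last v t) (s (v :: t)).

(* sig is a strategy profile for the players -i from v
   (the component of i is irrelevant) *)
Definition prof_minus_from (i : Pi) (v : V) (sig : profile) : Prop :=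
  forall j, j != i -> strat_from j v (sig j).

Definition upd (sig : profile) (i : Pi) (si : strategy) : profile :=
  fun j => if j == i then si else sig j.

Fixpoint ohist (sig : profile) (v : V) (n : nat) : seq V :=
  match n with
  | 0 => [:: v]
  | n'.+1 => let h := ohist sig v n' in rcons h (sig (owner (last v h)) h)
  end.

Definition outcome (sig : profile) (v : V) : nat -> V :=
  fun n => last v (ohist sig v n).

Definition suffix (rho : nat -> V) (n : nat) : nat -> V := fun k => rho (n + k)%N.

Definition requirement := V -> \bar R.

Definition lconsistent (lam : requirement) (rho : nat -> V) : Prop :=
  forall (j : Pi) (n : nat), owner (rho n) = j -> lam (rho n) <= (mu (suffix rho n) j)%:E.

Definition history_from (v : V) (hu : seq V) : Prop :=
  exists t, hu = v :: t /\ path E v t.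

Definition compatible (i : Pi) (sig : profile) (v : V) (hu : seq V) : Prop :=
  forall k, (k.+1 < size hu)%N -> owner (nth v hu k) != i ->
    nth v hu k.+1 = sig (owner (nth v hu k)) (take k.+1 hu).

(* sig_{|hu} : sig_{j|hu}(h') = sig_j(h h') where hu = h u and h' starts at u *)
Definition shift (sig : profile) (hu : seq V) : profile :=
  fun j h' => sig j (match hu with [::] => h' | x :: t => belast x t ++ h' end).

Definition lRat (lam : requirement) (i : Pi) (v : V) (sig : profile) : Prop :=
  prof_minus_from i v sig /\
  exists si, strat_from i v si /\
    forall hu, history_from v hu -> compatible i sig v hu ->
      lconsistent lam (outcome (shift (upd sig i si) hu) (last v hu)).

Definition best_resp_val (i : Pi) (v : V) (sig : profile) : \bar R :=
  ereal_sup [set (mu (outcome (upd sig i si) v) i)%:E | si in strat_from i v].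

(* nego(lambda)(v), for v in V_i; inf of the empty set is +oo *)
Definition nego (lam : requirement) (i : Pi) (v : V) : \bar R :=
  ereal_inf [set best_resp_val i v sig | sig in lRat lam i v].

Definition steady_negotiation : Prop :=
  forall (lam : requirement) (i : Pi) (v : V), owner v = i ->
    lRat lam i v !=set0 ->
    exists2 sig, lRat lam i v sig & best_resp_val i v sig = nego lam i v.

(* Prover's states V x 2^V, Challenger's states E x 2^V *)
Inductive cstate :=
| PState of V & {set V}
| CState of V & V & {set V}.

Definition is_prover (s : cstate) : bool :=
  if s is PState _ _ then true else false.

Definition conc_edge (i : Pi) (s s' : cstate) : bool :=
  match s, s' with
  | PState v M, CState v' w M' =>
      [&& v' == v, E v w & M' == M]
  | CState u v M, PState w M' =>
      [&& w == v & M' == v |: M]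
      || [&& owner u == i, E u w, w != v & M' == [set w]%SET]
  | _, _ => false
  end.

Definition is_deviation (s s' : cstate) : bool :=
  match s, s' with
  | CState u v M, PState w M' => w != v
  | _, _ => false
  end.

Definition cvertex (s : cstate) : V :=
  match s with PState v _ => v | CState u _ _ => u end.

Definition cstrategy := seq cstate -> cstate.

Definition prover_strat (i : Pi) (s0 : cstate) (tau : cstrategy) : Prop :=
  forall t, path (conc_edge i) s0 t -> is_prover (last s0 t) ->
    conc_edge i (last s0 t) (tau (s0 :: t)).

Definition challenger_strat (i : Pi) (s0 : cstate) (tau : cstrategy) : Prop :=
  forall t, path (conc_edge i) s0 t -> ~~ is_prover (last s0 t) ->
    conc_edge i (last s0 t) (tau (s0 :: t)).

Fixpoint chist (tauP tauC : cstrategy) (s0 : cstate) (n : nat) : seq cstate :=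
  match n with
  | 0 => [:: s0]
  | n'.+1 => let h := chist tauP tauC s0 n' in
      rcons h (if is_prover (last s0 h) then tauP h else tauC h)
  end.

Definition coutcome (tauP tauC : cstrategy) (s0 : cstate) : nat -> cstate :=
  fun n => last s0 (chist tauP tauC s0 n).

(* projection of a play: vertex components of Prover's states *)
Definition projection (pi : nat -> cstate) : nat -> V :=
  fun n => cvertex (pi (2 * n)%N).

Definition nuC (lam : requirement) (i : Pi) (pi : nat -> cstate) : \bar R :=
  if pselect (exists n, (forall k, (2 * n <= k)%N -> ~~ is_deviation (pi k) (pi k.+1))
                        /\ ~ lconsistent lam (suffix (projection pi) n))
  then +oo else (mu (projection pi) i)%:E.

Definition conc_lower_val (lam : requirement) (i : Pi) (s0 : cstate) : \bar R :=
  ereal_sup [set ereal_inf [set nuC lam i (coutcome tauP tauC s0)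
                           | tauP in prover_strat i s0]
            | tauC in challenger_strat i s0].

Definition conc_upper_val (lam : requirement) (i : Pi) (s0 : cstate) : \bar R :=
  ereal_inf [set ereal_sup [set nuC lam i (coutcome tauP tauC s0)
                           | tauC in challenger_strat i s0]
            | tauP in prover_strat i s0].

Definition prover_optimal (lam : requirement) (i : Pi) (s0 : cstate)
  (tauP : cstrategy) : Prop :=
  prover_strat i s0 tauP /\
  ereal_sup [set nuC lam i (coutcome tauP tauC s0) | tauC in challenger_strat i s0]
  = conc_upper_val lam i s0.

End Game.

(* Main.v *)
Require Import Defs.
From mathcomp Require Import all_boot all_order all_algebra.
From mathcomp Require Import all_classical all_reals all_analysis.
From mathcomp Require Import Rstruct Rstruct_topology.
From mathcomp Require Import zify.
Set Implicit Arguments.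
Unset Strict Implicit.
Unset Printing Implicit Defensive.
Import Order.TTheory GRing.Theory Num.Theory numFieldNormedType.Exports.
Local Open Scope classical_set_scope.

(** The heart of the matter is that the lower and the upper value agree, which is Borel
    determinacy, proved here by Martin's unraveling.  A covering of a game tree [T] is a
    tree [T'] projecting onto [T] together with a map of strategies from [T'] to [T] such
    that every play following the image of a strategy [s] lifts to a play following [s].
    Every open set of plays becomes decided at a finite level in a suitable covering: the
    player moving at level [m] announces a quasi-strategy [A], and the opponent either
    exhibits a position of [A] that lies in the open set, or announces a quasi-strategy
    inside [A] that avoids it.  Coverings can be composed, and a sequence of coverings
    changing less and less of the tree has an inverse limit, so the sets that can be
    unraveled form a sigma-algebra.  Prefix independence makes [{nuC > c}] a Borel set.

    The equality with [nego] is a translation of strategies.  A rational profile of the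
    coalition, together with a witnessing strategy of player [i], is a proposal strategy
    of Prover.  Conversely a Prover strategy of finite value gives a profile by replaying
    each history in the concrete game, where Challenger accepts the proposals agreeing
    with the history and deviates otherwise; since the value is finite, accepting forever
    from any point yields a consistent play.  This translation does not increase the
    value, so an optimal Prover strategy attains the infimum. *)

(** * Game trees *)

(** Choice made total: the default [x0] is returned only when nothing satisfies [P]. *)
Definition pick_in (T : Type) (x0 : T) (P : T -> Prop) : T :=
  if pselect (exists x, P x) is left e then projT1 (cid e) else x0.

Lemma pick_inP (T : Type) (x0 : T) (P : T -> Prop) :
  (exists x, P x) -> P (pick_in x0 P).
Proof. by rewrite /pick_in => e; case: pselect => // e'; case: (cid e'). Qed.

Lemma first_nat (P : nat -> Prop) n :
  P n -> exists k, [/\ k <= n, P k & forall j, P j -> k <= j].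
Proof.
move=> Pn; have ex : exists k, `[< P k >] by exists n; apply/asboolP.
exists (ex_minn ex); case: ex_minnP => k /asboolP Pk kmin; split=> //.
  exact/kmin/asboolP.
by move=> j Pj; exact/kmin/asboolP.
Qed.

(* Only the elements satisfying [ok] are positions; player [b] moves at the positions
   whose length has parity [b]. *)
Record gtree := GTree {
  pos :> Type;
  ok : pos -> Prop;
  child : pos -> pos -> Prop;
  len : pos -> nat;
  child_ok : forall p q, child p q -> ok p /\ ok q;
  child_len : forall p q, child p q -> len q = (len p).+1;
  child_inj : forall p p' q, child p q -> child p' q -> p = p';
  pruned : forall p, ok p -> exists q, child p q;
  rooted : forall q, ok q -> 0 < len q -> exists p, child p q }.

Section Tree.
Variable T : gtree.
Implicit Types (p q r : T) (x : nat -> T) (s : T -> T) (b : bool).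

Definition play x := [/\ ok (x 0), len (x 0) = 0 & forall n, child (x n) (x n.+1)].

Definition strat b s := forall p, ok p -> odd (len p) = b -> child p (s p).

Definition follows b s x := forall n, odd n = b -> x n.+1 = s (x n).

Definition agree b n s s' :=
  forall p, ok p -> odd (len p) = b -> len p < n -> s p = s' p.

Definition succ p : T := pick_in p (child p).

Lemma succP p : ok p -> child p (succ p).
Proof. by move=> /pruned; apply: pick_inP. Qed.

Lemma play_ok x n : play x -> ok (x n).
Proof. by case=> ? _ h; case: n => // n; case: (child_ok (h n)). Qed.

Lemma play_len x n : play x -> len (x n) = n.
Proof. by case=> _ h0 h; elim: n => // n IHn; rewrite (child_len (h n)) IHn. Qed.

Lemma play_child x n : play x -> child (x n) (x n.+1).
Proof. by case. Qed.

Inductive desc p : T -> Prop :=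
| desc_refl : desc p p
| desc_step q r : desc p q -> child q r -> desc p r.

Lemma desc_child p q : child p q -> desc p q.
Proof. by apply: desc_step; apply: desc_refl. Qed.

Lemma desc_trans q p r : desc p q -> desc q r -> desc p r.
Proof. by move=> pq; elim=> // r1 r2 _ IH c; exact: desc_step IH c. Qed.

Lemma desc_len p q : desc p q -> len p <= len q.
Proof. by elim=> // q' r _ IH /child_len ->; apply: leqW. Qed.

Lemma desc_okr p q : ok p -> desc p q -> ok q.
Proof. by move=> okp [|q' r _ /child_ok[]]. Qed.

Lemma desc_parent p q r : desc p r -> child q r -> p = r \/ desc p q.
Proof. by move=> [|q' r' d c] c'; [left|right; rewrite (child_inj c' c)]. Qed.

(** Parents are unique, so the ancestors of [r] form a chain ordered by level. *)
Lemma desc_comp p q r : desc p r -> desc q r -> len p <= len q -> desc p q.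
Proof.
move=> dp dq; elim: dq dp => // q' r' dq IH c dp le.
case: (desc_parent dp c) => [e|d]; last exact: IH.
by move: le; rewrite e (child_len c) leqNgt ltnS (desc_len dq).
Qed.

Lemma desc_len_eq p q : desc p q -> len q <= len p -> p = q.
Proof. by case=> // q' r d /child_len ->; rewrite ltnNge (desc_len d). Qed.

Lemma desc_eq p q r : desc p r -> desc q r -> len p = len q -> p = q.
Proof.
by move=> dp dq e; apply: desc_len_eq; [apply: desc_comp dp dq _; rewrite e|rewrite e].
Qed.

Lemma desc_next p q : desc p q -> p = q \/ exists2 r, child p r & desc r q.
Proof.
elim=> [|q' r d [e|[r' c d']] c']; [by left| |].
  by right; exists r; [rewrite e|exact: desc_refl].
by right; exists r' => //; exact: desc_step d' c'.
Qed.

Lemma desc_ex n q : ok q -> n <= len q -> exists p, desc p q /\ len p = n.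
Proof.
move=> + le; have := subnKC le; move: (len q - n) => d; elim: d q {le} => [|d IH] q e okq.
  by exists q; split; [exact: desc_refl|rewrite -e addn0].
have [p c] : exists p, child p q by apply: rooted => //; rewrite -e addnS.
have [|p' [dp' <-]] := IH p _ (child_ok c).1.
  by apply: succn_inj; rewrite -addnS e (child_len c).
by exists p'; split=> //; exact: desc_step dp' c.
Qed.

(** The value is [q] itself, as junk, when level [n] lies beyond [q]. *)
Definition anc n q := pick_in q (fun p => desc p q /\ len p = n).

Lemma ancP n q : ok q -> n <= len q -> desc (anc n q) q /\ len (anc n q) = n.
Proof. by move=> okq le; apply: (pick_inP q (desc_ex okq le)). Qed.

Lemma anc_desc p q : desc p q -> anc (len p) q = p.
Proof.
move=> d; have [d' e] := @pick_inP _ q (fun r => desc r q /\ len r = len p)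
  (ex_intro _ p (conj d erefl)).
exact: desc_eq d' d e.
Qed.

Lemma anc_id q : anc (len q) q = q.
Proof. exact/anc_desc/desc_refl. Qed.

Lemma play_desc x i j : play x -> i <= j -> desc (x i) (x j).
Proof.
move=> px; elim: j => [|j IH]; first by rewrite leqn0 => /eqP ->; exact: desc_refl.
rewrite leq_eqVlt => /orP[/eqP ->|]; first exact: desc_refl.
by rewrite ltnS => /IH d; apply: desc_step d (play_child j px).
Qed.

Lemma play_anc x i j : play x -> i <= j -> anc i (x j) = x i.
Proof. by move=> px ij; rewrite -{1}(play_len i px); apply/anc_desc/play_desc. Qed.

Lemma play_desc_eq x p n : play x -> desc p (x n) -> p = x (len p).
Proof.
move=> px d; have le := desc_len d; rewrite (play_len n px) in le.
by apply: desc_eq d (play_desc px le) _; rewrite play_len.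
Qed.

(** The attractor of [U] for player [b], as a least fixed point. Branching may be infinite, so
    derivations are well-founded trees rather than bounded iterations; outside the attractor the
    opponent can always stay outside. *)
Inductive reach b (U : T -> Prop) : T -> Prop :=
| reach_here p : U p -> reach b U p
| reach_own p q : odd (len p) = b -> child p q -> reach b U q -> reach b U p
| reach_opp p : ok p -> odd (len p) <> b -> (forall q, child p q -> reach b U q) ->
    reach b U p.

Lemma reach_notown b U p q : ~ reach b U p -> odd (len p) = b -> child p q ->
  ~ reach b U q.
Proof. by move=> nr o c r; apply: nr; apply: reach_own o c r. Qed.

Lemma reach_notopp b U p : ok p -> ~ reach b U p -> odd (len p) <> b ->
  exists2 q, child p q & ~ reach b U q.
Proof.
move=> okp nr o; apply: contrapT => h; apply: nr; apply: reach_opp => // q c.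
by apply: contrapT => nq; apply: h; exists q.
Qed.

(* The strategy [s] is only followed until [U] is entered. *)
Definition reaching b (U : T -> Prop) p s := strat b s /\
  forall x n, play x -> x n = p ->
    (forall k, n <= k -> (forall j, n <= j -> j <= k -> ~ U (x j)) ->
       odd k = b -> x k.+1 = s (x k)) ->
    exists2 k, n <= k & U (x k).

(** Induction on the derivation: at an own position, prescribe the move to [q] and continue as from
    [q]; at an opponent position, glue strategies chosen for the children. *)
Lemma reach_strat b U p : reach b U p -> exists s, reaching b U p s.
Proof.
elim=> {p} [p Up|p q o c _ [s [ss hs]]|p okp o _ IH].
- exists succ; split=> [q okq _|x n _ e _]; first exact: succP.
  by exists n; rewrite ?e.
- exists (fun r => if pselect (r = p) then q else s r); split.
    by move=> r okr or; case: pselect => [e|_] /=; [rewrite e|exact: ss].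
  move=> x n px e h.
  have [Un|nUn] := pselect (U (x n)); first by exists n.
  have xn1 : x n.+1 = q.
    have nU j : n <= j -> j <= n -> ~ U (x j).
      by move=> h1 h2; have -> : j = n by apply/eqP; rewrite eqn_leq h1 h2.
    have := h n (leqnn n) nU; rewrite -{1}(play_len n px) e => /(_ o).
    by case: pselect.
  have [|k lek Uk] := hs x n.+1 px xn1; last by exists k => //; exact: ltnW.
    move=> k nk nU ok; rewrite (h k (ltnW nk)) // => [|j nj jk].
      case: pselect => //= xkp; exfalso; move: (play_len k px).
      by rewrite xkp -e (play_len n px) => enk; rewrite enk ltnn in nk.
    move: nj; rewrite leq_eqVlt => /orP[/eqP <-//|nj]; exact: nU.
- pose F q := pick_in succ (reaching b U q).
  have FP q : child p q -> reaching b U q (F q) by move=> /IH; exact: pick_inP.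
  (* The ancestor of [r] one level after [p] reveals which child the opponent chose. *)
  exists (fun r => if pselect (child p (anc (len p).+1 r)) then F (anc (len p).+1 r) r
                   else succ r); split.
    move=> r okr or; case: pselect => [c|_] /=; [exact: (FP _ c).1|exact: succP].
  move=> x n px e h.
  have cn : child p (x n.+1) by rewrite -e; exact: play_child.
  have [ss hs] := FP _ cn.
  have [Un|nUn] := pselect (U (x n)); first by exists n.
  have [|k lek Uk] := hs x n.+1 px erefl; last by exists k => //; exact: ltnW.
  move=> k nk nU okk; rewrite (h k (ltnW nk)) // => [|j nj jk].
    have -> : anc (len p).+1 (x k) = x n.+1.
      by rewrite -e (play_len n px) play_anc.
    by case: pselect.
  by move: nj; rewrite leq_eqVlt => /orP[/eqP <-//|nj]; exact: nU.
Qed.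

Definition reach_sel b U p := pick_in succ (reaching b U p).

Lemma reach_selP b U p : reach b U p -> reaching b U p (reach_sel b U p).
Proof. by move=> /reach_strat; exact: pick_inP. Qed.

(** Repairs an illegal move, which turns any function into a strategy. *)
Definition fix_child p q := if pselect (child p q) then q else succ p.

Lemma fix_childP p q : ok p -> child p (fix_child p q).
Proof. by rewrite /fix_child; case: pselect => //= _; exact: succP. Qed.

Lemma fix_child_id p q : child p q -> fix_child p q = q.
Proof. by rewrite /fix_child; case: pselect. Qed.

(** A position determines its past, so a strategy can recover the moment of first entry from the
    current position alone. *)
Definition first_in n0 (U : T -> Prop) p := pick_in p (fun r =>
  [/\ U r, desc r p, n0 <= len r &
      forall r', U r' -> desc r' p -> n0 <= len r' -> len r <= len r']).

Definition entered n0 (U : T -> Prop) p := exists r, [/\ U r, desc r p & n0 <= len r].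

Lemma play_entered n0 U x n : play x ->
  entered n0 U (x n) <-> exists k, [/\ U (x k), n0 <= k & k <= n].
Proof.
move=> px; split=> [[r [Ur d le]]|[k [Uk n0k kn]]].
  exists (len r); rewrite -(play_desc_eq px d); split=> //.
  by rewrite -(play_len n px); exact: desc_len.
exists (x k); split=> //; last by rewrite play_len.
exact: play_desc.
Qed.

Lemma play_first n0 U x k n : play x -> U (x k) -> n0 <= k -> k <= n ->
  (forall j, n0 <= j -> U (x j) -> k <= j) -> first_in n0 U (x n) = x k.
Proof.
move=> px Uk n0k kn kmin.
have ex : exists r, [/\ U r, desc r (x n), n0 <= len r &
      forall r', U r' -> desc r' (x n) -> n0 <= len r' -> len r <= len r'].
  exists (x k); rewrite play_len //; split=> //; first exact: play_desc.
  by move=> r' Ur' d le; apply: kmin => //; rewrite -(play_desc_eq px d).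
have [Ur d le rmin] := pick_inP (x n) ex; rewrite -/(first_in n0 U (x n)) in Ur d le rmin.
rewrite (play_desc_eq px d); congr x; apply/eqP; rewrite eqn_leq.
rewrite kmin -?(play_desc_eq px d) // andbT.
have := rmin _ Uk (play_desc px kn); rewrite play_len //; exact.
Qed.

(* While [reach b U] has not been entered since level [n0], play [safe]; from the
   moment it is entered, force [U]; once [U] is reached at [r], play [hit r]. *)
Definition three_phase b n0 U (hit : T -> T -> T) (safe : T -> T) p :=
  if pselect (entered n0 U p) then hit (first_in n0 U p) p
  else if pselect (entered n0 (reach b U) p)
  then reach_sel b U (first_in n0 (reach b U) p) p
  else safe p.

(** If the attractor is never entered from level [n0] on, both tests always fail. Otherwise the
    forcing strategy selected at the first entry leads to [U], and the first visit to [U] starts the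
    last phase for good. *)
Lemma three_phaseP b n0 U hit safe x : play x ->
  (forall n, n0 <= n -> odd n = b ->
     x n.+1 = fix_child (x n) (three_phase b n0 U hit safe (x n))) ->
  (forall n, n0 <= n -> ~ reach b U (x n) /\
     (odd n = b -> x n.+1 = fix_child (x n) (safe (x n)))) \/
  (exists n1, [/\ n0 <= n1, U (x n1) & forall n, n1 <= n -> odd n = b ->
     x n.+1 = fix_child (x n) (hit (x n1) (x n))]).
Proof.
move=> px h.
have [[k0 [Wk0 n0k0]]|nW] := pselect (exists k, reach b U (x k) /\ n0 <= k); last first.
  left=> n n0n; split=> [W|o]; first by apply: nW; exists n.
  rewrite (h n n0n o) /three_phase.
  case: pselect => [e|_] /=.
    have [k [Uk n0k _]] := (play_entered _ _ _ px).1 e.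
    by case: nW; exists k; split=> //; exact: reach_here.
  case: pselect => //= e; have [k [Wk n0k _]] := (play_entered _ _ _ px).1 e.
  by case: nW; exists k.
right.
have [k1 [_ [Wk1 n0k1] k1min]] := 
  @first_nat (fun k => reach b U (x k) /\ n0 <= k) k0 (conj Wk0 n0k0).
have {k0 Wk0 n0k0} [k2 lek2 Uk2] : exists2 k, k1 <= k & U (x k).
  have [ss hs] := reach_selP Wk1; apply: (hs _ _ px erefl) => k k1k nU o.
  rewrite (h k (leq_trans n0k1 k1k) o) /three_phase.
  (* A visit to [U] is a visit to the attractor, hence not before [k1], and [nU] excludes those
     between [k1] and [k]. *)
  case: pselect => [e|_] /=.
    have [j [Uj n0j jk]] := (play_entered _ _ _ px).1 e.
    by case: (nU j) => //; apply: k1min; split=> //; exact: reach_here.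
  case: pselect => [e|[]] /=; last by apply/play_entered => //; exists k1.
  rewrite (play_first px Wk1 n0k1) // => [|j n0j Wj]; last exact: k1min.
  by apply: fix_child_id; apply: ss; rewrite ?play_len //; exact: play_ok.
have [n1 [_ [Un1 n0n1] n1min]] := 
  @first_nat (fun k => U (x k) /\ n0 <= k) k2 (conj Uk2 (leq_trans n0k1 lek2)).
exists n1; split=> // n n1n o; rewrite (h n (leq_trans n0n1 n1n) o) /three_phase.
case: pselect => [e|[]] /=; last by apply/play_entered => //; exists n1.
by rewrite (play_first px Un1 n0n1) // => j n0j Uj; exact: n1min.
Qed.

End Tree.

(** * Coverings and their inverse limits *)

(* [cpush_local] is what makes strategies converge along an inverse limit. *)
Record covering (T' T : gtree) := Covering {
  cproj :> T' -> T;
  cpush : bool -> (T' -> T') -> (T -> T);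
  cproj_ok : forall p, ok p -> ok (cproj p);
  cproj_len : forall p, ok p -> len (cproj p) = len p;
  cproj_child : forall p q, child p q -> child (cproj p) (cproj q);
  cpush_strat : forall b s, strat b s -> strat b (cpush b s);
  cpush_local : forall b n s s', strat b s -> strat b s' ->
    agree b n s s' -> agree b n (cpush b s) (cpush b s');
  cpush_lift : forall b s x, strat b s -> play x -> follows b (cpush b s) x ->
    exists x', [/\ play x', follows b s x' & forall n, cproj (x' n) = x n] }.

(** Martin's $k$-coverings, with $k$ = [m]: up to level [m] the two trees are identified, and moves
    made below that level are pushed unchanged. *)
Record fixes (m : nat) (T' T : gtree) (C : covering T' T) := Fixes {
  fixes_inj : forall p q, ok p -> ok q -> len p <= m -> C p = C q -> p = q;
  fixes_surj : forall q, ok q -> len q <= m -> exists2 p, ok p & C p = q;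
  fixes_push : forall b s p, strat b s -> ok p -> len p < m -> odd (len p) = b ->
    cpush C b s (C p) = C (s p) }.

Lemma cproj_play (T' T : gtree) (C : covering T' T) x : play x -> play (C \o x).
Proof.
case=> o l c; split=> [||n] /=; first exact: cproj_ok.
  by rewrite cproj_len.
exact: cproj_child.
Qed.

(** * Composition of coverings *)

Section Comp.
Variables (T2 T1 T0 : gtree) (D : covering T2 T1) (C : covering T1 T0).

Definition comp_covering : covering T2 T0.
Proof.
exists (C \o D) (fun b s => cpush C b (cpush D b s)).
- by move=> p okp; do 2 apply: cproj_ok.
- by move=> p okp /=; rewrite !cproj_len //; apply: cproj_ok.
- by move=> p q c; do 2 apply: cproj_child.
- by move=> b s ss; do 2 apply: cpush_strat.
- move=> b n s s' ss ss' a; apply: cpush_local; try exact: cpush_strat.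
  exact: cpush_local.
- move=> b s x ss px fx.
  have [x1 [px1 fx1 e1]] := cpush_lift (cpush_strat D ss) px fx.
  have [x2 [px2 fx2 e2]] := cpush_lift ss px1 fx1.
  by exists x2; split=> // n /=; rewrite e2.
Defined.

Lemma comp_fixes m : fixes m D -> fixes m C -> fixes m comp_covering.
Proof.
move=> fD fC; split=> [p q okp okq l /= e|q okq l|b s p ss okp l o /=].
- apply: (fixes_inj fD) => //; apply: (fixes_inj fC) => //; try exact: cproj_ok.
  by rewrite cproj_len.
- have [p okp e] := fixes_surj fC okq l.
  have [|r okr e'] := fixes_surj fD okp; first by rewrite -(cproj_len C okp) e.
  by exists r => //=; rewrite e'.
- rewrite (fixes_push fC) ?cproj_len //; last 2 first.
  + exact: cpush_strat.
  + exact: cproj_ok.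
  by rewrite (fixes_push fD).
Qed.

End Comp.

Definition id_covering (T : gtree) : covering T T.
Proof.
exists id (fun _ s => s) => //.
by move=> b s x ss px fx; exists x.
Defined.

Lemma id_fixes m T : fixes m (id_covering T).
Proof. by split=> // q okq _; exists q. Qed.

(** Threads of the inverse system. *)
Definition coherent (T : nat -> gtree) (C : forall i, covering (T i.+1) (T i))
    (y : forall i, T i) := (forall i, ok (y i)) /\ forall i, C i (y i.+1) = y i.

Lemma coherent_len T C y i j : @coherent T C y -> len (y i) = len (y j).
Proof.
move=> [ o e].
have h k : len (y k) = len (y 0).
  by elim: k => // k <-; rewrite -(e k) cproj_len.
by rewrite !h.
Qed.

(** Components above [j] are determined by injectivity of the coverings at fixed levels, those below
    [j] by projection. *)
Lemma coherent_inj m T C y z j : (forall i, fixes (m + i) (C i)) ->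
  @coherent T C y -> @coherent T C z -> len (y j) <= m + j -> y j = z j -> y = z.
Proof.
move=> fC cy cz l e; apply: functional_extensionality_dep.
have up d : y (d + j) = z (d + j).
  elim: d => // d IH; have [oy ey] := cy; have [oz ez] := cz.
  apply: (fixes_inj (fC (d + j))); rewrite -?IH //; try exact: oy; try exact: oz.
    rewrite (coherent_len _ j cy); apply: (leq_trans l).
    by rewrite leq_add2l leq_addl.
  by rewrite [LHS](ey (d + j)) [RHS](ez (d + j)).
move=> i; have [ij|ij] := leqP j i; first by rewrite -(subnK ij).
have down d : forall i, y (d + i) = z (d + i) -> y i = z i.
  elim: d => // d IH k e'; apply: IH.
  by rewrite -[LHS](proj2 cy) -[RHS](proj2 cz); congr (C _ _); exact: e'.
by apply: (down (j - i)); rewrite subnK // ltnW.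
Qed.

(** Lift upwards by surjectivity at fixed levels, project downwards. Induction on [j] shifts the
    whole sequence and replaces [m] by [m.+1], which avoids casts between the trees. *)
Lemma coherent_ext m (T : nat -> gtree) (C : forall i, covering (T i.+1) (T i))
    j (q : T j) : (forall i, fixes (m + i) (C i)) ->
  ok q -> len q <= m + j -> exists2 y, coherent C y & y j = q.
Proof.
elim: j m T C q => [|j IH] m T C q fC okq l.
  rewrite addn0 in l.
  pose Q i := {p : T i | ok p /\ len p <= m}.
  have step i (p : Q i) : {p' : Q i.+1 | C i (sval p') = sval p}.
    case: p => p [okp lp]; apply: cid.
    have [|p' okp' e] := fixes_surj (fC i) okp; first exact/(leq_trans lp)/leq_addr.
    have l' : len p' <= m by rewrite -(cproj_len (C i) okp') e.
    by exists (exist _ p' (conj okp' l')).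
  pose y := fix y i : Q i := match i return Q i with
    | 0 => exist _ q (conj okq l) | i'.+1 => sval (step i' (y i')) end.
  exists (fun i => sval (y i)) => //; split=> i; first exact: (proj1 (svalP (y i))).
  by rewrite /=; case: (step i (y i)).
have [||y' [oy ey] e] := IH m.+1 (fun i => T i.+1) (fun i => C i.+1) q _ okq.
- by move=> i; rewrite addSnnS; exact: fC.
- by rewrite addSnnS.
exists (fun i => match i return T i with 0 => C 0 (y' 0) | i'.+1 => y' i' end) => //.
by split; case=> //; apply: cproj_ok.
Qed.

(** * The inverse limit of a sequence of coverings *)

Section Limit.
Variables (T : nat -> gtree) (C : forall i, covering (T i.+1) (T i)) (m : nat).
Hypothesis fC : forall i, fixes (m + i) (C i).

Definition lim_child (y z : forall i, T i) :=
  [/\ coherent C y, coherent C z & forall i, child (y i) (z i)].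

Lemma lim_child_down d i y z : coherent C y -> coherent C z ->
  child (y (d + i)) (z (d + i)) -> child (y i) (z i).
Proof.
move=> cy cz; elim: d => // d IH c; apply: IH.
by rewrite -(proj2 cy (d + i)) -(proj2 cz (d + i)); exact: cproj_child.
Qed.

(** For an index above [j], extend the parent of [z i] to a thread; uniqueness of parents makes it
    agree with [y] at index [j], hence everywhere. *)
Lemma lim_child_at j y z : coherent C y -> coherent C z -> child (y j) (z j) ->
  len (z j) <= m + j -> lim_child y z.
Proof.
move=> cy cz c l; split=> // i.
have [ij|ji] := leqP i j.
  by apply: (@lim_child_down (j - i)) => //; rewrite subnK.
have ezj : len (z i) = len (z j) by apply: coherent_len cz.
have [p cp] : exists p, child p (z i).
  by apply: rooted (cz.1 i) _; rewrite ezj (child_len c).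
have [|y' cy' e] := coherent_ext fC (child_ok cp).1.
  have := child_len cp; lia.
suff -> : y = y' by rewrite e.
apply: (coherent_inj (j := j) fC) => //; first by have := child_len c; lia.
apply: child_inj c _; apply: (@lim_child_down (i - j)) => //.
by rewrite subnK ?e // ltnW.
Qed.

Definition lim_tree : gtree.
Proof.
exists (forall i, T i) (coherent C) lim_child (fun y => len (y 0)).
- by move=> y z [].
- by move=> y z [_ _ /(_ 0)/child_len].
- move=> y y' z [_ _ c] [_ _ c']; apply: functional_extensionality_dep => i.
  exact: child_inj (c i) (c' i).
(* At this index the level of a child is at most [m + j], so a single component determines its
   thread. *)
- move=> y cy; set j := (len (y 0)).+1.
  have [q c] := pruned (cy.1 j).
  have lq : len q = j by rewrite (child_len c) (coherent_len _ 0 cy).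
  have [|z cz e] := coherent_ext fC (child_ok c).2; first by rewrite lq leq_addl.
  by exists z; apply: (@lim_child_at j); rewrite ?e // lq leq_addl.
- move=> z cz l; set j := len (z 0).
  have lz : len (z j) = j by apply: coherent_len cz.
  have [p c] : exists p, child p (z j) by apply: rooted (cz.1 j) _; rewrite lz.
  have [|y cy e] := coherent_ext fC (child_ok c).1.
    by have := child_len c; lia.
  by exists y; apply: (@lim_child_at j); rewrite ?e // lz leq_addl.
Defined.

Lemma lim_len (y : lim_tree) i : ok y -> len (y i) = len y.
Proof. exact: coherent_len. Qed.

Lemma lim_inj j (y z : lim_tree) : ok y -> ok z -> len y <= m + j -> y j = z j -> y = z.
Proof.
by move=> oky okz l; apply: (coherent_inj fC) => //; rewrite (lim_len j oky).
Qed.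

(** Up to level [m + j] a position of [T j] belongs to exactly one thread, where [s] can be
    consulted; from that level on the move is arbitrary. *)
Definition lim_restr (s : lim_tree -> lim_tree) j (p : T j) : T j :=
  if len p < m + j then pick_in p (fun q => exists y : lim_tree, [/\ ok y, y j = p & q = s y j])
  else succ p.

Lemma lim_restrE s j (y : lim_tree) : ok y -> len y < m + j -> lim_restr s (y j) = s y j.
Proof.
move=> oky l; rewrite /lim_restr (lim_len j oky) l.
have ex : exists q, exists z : lim_tree, [/\ ok z, z j = y j & q = s z j] by exists (s y j), y.
have [z [okz e ->]] := pick_inP (y j) ex.
by rewrite (lim_inj oky okz (ltnW l) (esym e)).
Qed.

Lemma lim_restr_strat b s j : strat b s -> strat b (@lim_restr s j).
Proof.
move=> ss p okp o; case: (ltnP (len p) (m + j)) => [l|l]; last first.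
  by rewrite /lim_restr ltnNge l; exact: succP.
have [y oky e] := coherent_ext fC okp (ltnW l).
have ey : len (y j) = len (y : lim_tree) by apply: lim_len.
rewrite -e lim_restrE //; last by rewrite -ey e.
by have [|_ _] := ss y oky; first by rewrite -ey e.
Qed.

Lemma lim_restr_agree b n s s' j : agree b n s s' ->
  agree b n (@lim_restr s j) (@lim_restr s' j).
Proof.
move=> a p okp o l; have [l'|l'] := ltnP (len p) (m + j); last first.
  by rewrite /lim_restr ltnNge l'.
have [y oky e] := coherent_ext fC okp (ltnW l').
have ey : len (y j) = len (y : lim_tree) by apply: lim_len.
by rewrite -e !lim_restrE -?ey ?e // a // -ey e.
Qed.

(* [lim_push b s d i] pushes the restriction of [s] to [T (d + i)] down to [T i]; the
   recursion is arranged so that no transport between tree types is needed. *)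
Fixpoint lim_push b s d : forall i, T i -> T i :=
  match d with
  | 0 => fun i => @lim_restr s i
  | d'.+1 => fun i => cpush (C i) b (lim_push b s d' (i := i.+1))
  end.

Lemma lim_push_strat b s d i : strat b s -> strat b (@lim_push b s d i).
Proof.
move=> ss; elim: d i => [|d IH] i /=; first exact: lim_restr_strat.
exact: cpush_strat.
Qed.

Lemma lim_push_agree b n s s' d i : strat b s -> strat b s' -> agree b n s s' ->
  agree b n (@lim_push b s d i) (@lim_push b s' d i).
Proof.
move=> ss ss' a; elim: d i => [|d IH] i /=; first exact: lim_restr_agree.
by apply: cpush_local (IH _); exact: lim_push_strat.
Qed.

(** Starting one tree higher changes nothing below level [m + i + d], which the additional covering
    fixes; [cpush_local] carries this down to [T i]. *)
Lemma lim_push_step b s d i : strat b s ->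
  agree b (m + i + d) (@lim_push b s d.+1 i) (@lim_push b s d i).
Proof.
move=> ss; elim: d i => [|d IH] i.
  move=> p okp o; rewrite addn0 => l.
  have [y oky e] := coherent_ext fC okp (ltnW l).
  have ey j : len (y j) = len (y : lim_tree) by apply: lim_len.
  have ly : len (y : lim_tree) < m + i by rewrite -(ey i) e.
  have oy : odd (len (y : lim_tree)) = b by rewrite -(ey i) e.
  rewrite /= -e lim_restrE // -{1}(proj2 oky i).
  rewrite (fixes_push (fC i)) ?ey //; last 2 first.
  - exact: lim_restr_strat.
  - exact: (proj1 oky).
  rewrite lim_restrE //; last by rewrite addnS ltnS ltnW.
  by have /child_ok[_ [_ ->]] := ss _ oky oy.
have := IH i.+1; rewrite addnS addSnnS => h.
by apply: cpush_local h; exact: lim_push_strat.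
Qed.

(** The eventual value of [lim_push b s d p] as [d] grows; it is stationary as soon as
    [len p < m + i + d], hence at [d = (len p).+1]. *)
Definition lim_strat b s i (p : T i) : T i := lim_push b s (len p).+1 p.

Lemma lim_stratE b s d i (p : T i) : strat b s -> ok p -> odd (len p) = b ->
  len p < m + i + d -> lim_strat b s p = lim_push b s d p.
Proof.
move=> ss okp o l; rewrite /lim_strat.
have h e : forall d, len p < m + i + d -> lim_push b s (e + d) p = lim_push b s d p.
  by elim: e => // e IH d' l'; rewrite -(IH _ l') addSn lim_push_step //; lia.
have [le|le] := leqP d (len p).+1; first by rewrite -(subnK le) h.
by rewrite -(subnK (ltnW le)) h //; lia.
Qed.

Lemma lim_strat_strat b s i : strat b s -> strat b (@lim_strat b s i).
Proof. by move=> ss p okp o; apply: lim_push_strat. Qed.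

Lemma lim_strat_push b s i (p : T i) : strat b s -> ok p -> odd (len p) = b ->
  cpush (C i) b (@lim_strat b s i.+1) p = lim_strat b s p.
Proof.
move=> ss okp o; rewrite {2}/lim_strat /=.
apply: (@cpush_local _ _ (C i) b (len p).+1) => //; [exact: lim_strat_strat|exact: lim_push_strat|].
by move=> q okq oq lq; apply: lim_stratE => //; lia.
Qed.

(** Lift the play through one covering after another. Each level of the resulting plays is a thread,
    because [lim_strat_push] makes the strategies on successive trees compatible. *)
Lemma lim_lift b s x : strat b s -> play x -> follows b (@lim_strat b s 0) x ->
  exists x' : nat -> lim_tree, [/\ play x', follows b s x' & forall n, x' n 0 = x n].
Proof.
move=> ss px fx.
pose Q i := {z : nat -> T i | play z /\ follows b (@lim_strat b s i) z}.
have step i (z : Q i) : {z' : Q i.+1 | forall n, C i (sval z' n) = sval z n}.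
  case: z => z [pz fz]; apply: cid.
  have fz' : follows b (cpush (C i) b (@lim_strat b s i.+1)) z.
    move=> n o; rewrite fz // lim_strat_push // ?play_len //; exact: play_ok.
  have [z' [pz' fz'' e]] := cpush_lift (lim_strat_strat ss) pz fz'.
  by exists (exist _ z' (conj pz' fz'')).
pose y := fix y i : Q i := match i return Q i with
    | 0 => exist _ x (conj px fx) | i'.+1 => sval (step i' (y i')) end.
pose x' n : lim_tree := fun i => sval (y i) n.
have yP i : play (sval (y i)) /\ follows b (@lim_strat b s i) (sval (y i)) := svalP (y i).
have okx n : ok (x' n).
  split=> i; first exact: play_ok (yP i).1.
  by rewrite /x' /=; case: (step i (y i)).
have px' : play x'.
  split=> // [|n]; first by have [] := px.
  by split; [exact: okx|exact: okx|move=> i; exact: play_child (yP i).1].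
exists x'; split=> // n o.
have lx := play_len n px'.
have /child_ok[_ oks] : child (x' n) (s (x' n)) by apply: ss; rewrite ?lx.
(* At index [n.+1] positions of level [n.+1] determine their threads, and the limit strategy at
   level [n] is still the restriction of [s]. *)
apply: (@lim_inj n.+1) => //; first by rewrite play_len // leq_addl.
rewrite [LHS](yP n.+1).2 // (@lim_stratE b s 0) //=; last 3 first.
- exact: play_ok (yP _).1.
- by rewrite play_len //; exact: (yP _).1.
- by rewrite play_len; [lia|exact: (yP _).1].
by rewrite [LHS](@lim_restrE s n.+1 (x' n)) // lx; lia.
Qed.

Definition lim_covering : covering lim_tree (T 0).
Proof.
exists (fun y : lim_tree => y 0) (fun b s => @lim_strat b s 0).
- by move=> y [].
- by [].
- by move=> y z [].
- by move=> b s; exact: lim_strat_strat.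
- move=> b n s s' ss ss' a p okp o l.
  by rewrite /lim_strat (lim_push_agree _ ss ss' a).
- exact: lim_lift.
Defined.

Lemma lim_fixes : fixes m lim_covering.
Proof.
split=> [y z oky okz l e|q okq l|b s y ss oky l o].
- by apply: (@lim_inj 0) => //; rewrite addn0.
- have [|y cy e] := coherent_ext fC okq; first by rewrite addn0.
  by exists y.
- rewrite /= (@lim_stratE b s 0) ?addn0 //=; last exact: (proj1 oky).
  by rewrite lim_restrE ?addn0.
Qed.

Lemma lim_proj_play (x : nat -> lim_tree) i : play x -> play (fun n => x n i).
Proof.
move=> px; split=> [||n]; first exact: (proj1 (play_ok 0 px)).
  by rewrite lim_len ?(play_len 0 px) //; exact: play_ok.
by have [_ _] := play_child n px; apply.
Qed.

End Limit.

(** * Unraveling an open set *)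

Section Between.
Variable T : gtree.

Definition between (p : T) (G : T -> Prop) q :=
  desc p q /\ forall r, desc p r -> desc r q -> G r.

Lemma between_refl p (G : T -> Prop) : G p -> between p G p.
Proof.
move=> Gp; split=> [|r d d']; first exact: desc_refl.
by rewrite -(desc_len_eq d (desc_len d')).
Qed.

Lemma between_holds p G q : between p G q -> G q.
Proof. by case=> d; apply=> //; exact: desc_refl. Qed.

Lemma between_step p G q r : between p G q -> child q r -> G r -> between p G r.
Proof.
move=> [d h] c Gr; split=> [|r' d1 d2]; first exact: desc_step d c.
by case: (desc_parent d2 c) => [->//|]; exact: h.
Qed.

Lemma between_parent p G q r : between p G r -> child q r -> len p <= len q ->
  between p G q.
Proof.
move=> [d h] c l; split=> [|r' d1 d2]; last by apply: h => //; exact: desc_step d2 c.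
case: (desc_parent d c) => // e.
by move: l; rewrite e (child_len c) ltnn.
Qed.

Lemma anc_child n (q r : T) : child q r -> n <= len q -> anc n r = anc n q.
Proof.
move=> c l; have [d e] := ancP (child_ok c).1 l.
by rewrite -{1}e; apply/anc_desc/(desc_step d).
Qed.

Lemma anc_len n (q : T) : ok q -> n <= len q -> len (anc n q) = n.
Proof. by move=> okq l; case: (ancP okq l). Qed.

Lemma three_phase_ext b n0 U hit hit' safe safe' (p : T) :
  (forall r, hit r p = hit' r p) -> safe p = safe' p ->
  three_phase b n0 U hit safe p = three_phase b n0 U hit' safe' p.
Proof. by move=> h s; rewrite /three_phase h s. Qed.

End Between.

Section Unravel.
Variables (T : gtree) (m : nat) (O : T -> Prop).
Implicit Types (p q r : T) (A B : T -> Prop).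

(* A position of the unraveled tree: up to level [m] it is a position of [T] (and both
   sets are empty); from level [m.+1] on it carries the quasi-strategy [uA] of the player
   moving at level [m]; from level [m.+2] on it also carries the opponent's answer [uB],
   a subtree to which the play is confined.  That answer is either the cone of a position
   of [uA] lying in [O], or a quasi-strategy inside [uA] avoiding [O]. *)
Record upos := UPos { up : T; uA : T -> Prop; uB : T -> Prop }.

Definition emp : T -> Prop := fun=> False.

(** Ancestors of [s] are included, so that confinement to the cone forces the play to pass through
    [s]. *)
Definition cone s q := desc s q \/ desc q s.

(** A quasi-strategy of the player moving at level [m]: every opponent move is kept, and at least
    one own move. *)
Definition qsA A :=
  (forall q r, A q -> child q r -> odd (len q) <> odd m -> A r) /\
  (forall q, ok q -> A q -> odd (len q) = odd m -> exists2 r, child q r & A r).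

(** A quasi-strategy of the opponent inside [A], avoiding [O]: it keeps all moves of the announcing
    player that stay in [A], and at least one own move. *)
Definition qsB p A B :=
  [/\ B p, forall q, B q -> A q /\ ~ O q,
      forall q r, B r -> child q r -> m.+2 <= len q -> B q,
      forall q r, B q -> child q r -> odd (len q) = odd m -> A r -> B r &
      forall q, ok q -> B q -> odd (len q) <> odd m -> exists2 r, child q r & B r].

Definition okB p A B :=
  (exists s, [/\ A s, O s, desc p s & B = cone s]) \/ qsB p A B.

Record uok (y : upos) : Prop := UOk {
  uok_ok : ok (up y);
  uok_A0 : len (up y) <= m -> uA y = emp;
  uok_B0 : len (up y) <= m.+1 -> uB y = emp;
  uok_A : m < len (up y) -> uA y (anc m.+1 (up y)) /\ qsA (uA y);
  uok_B : m.+1 < len (up y) -> okB (anc m.+2 (up y)) (uA y) (uB y) /\ uB y (up y) }.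

Definition uchild (y z : upos) := [/\ uok y, uok z, child (up y) (up z),
  (m < len (up y) -> uA z = uA y) & (m.+1 < len (up y) -> uB z = uB y)].

Definition lab A B p :=
  UPos p (if m < len p then A else emp) (if m.+1 < len p then B else emp).

Lemma lab0 A B p : len p <= m -> lab A B p = UPos p emp emp.
Proof. by move=> l; rewrite /lab !ltnNge l (leqW l). Qed.

Lemma lab1 A B p : len p = m.+1 -> lab A B p = UPos p A emp.
Proof. by move=> l; rewrite /lab l ltnSn ltnn. Qed.

Lemma lab2 A B p : m.+1 < len p -> lab A B p = UPos p A B.
Proof. by move=> l; rewrite /lab l (ltnW l). Qed.

Lemma uok0 p : ok p -> len p <= m -> uok (UPos p emp emp).
Proof. by move=> okp l; split=> //= l'; lia. Qed.

Lemma uok1 p A : ok p -> len p = m.+1 -> A p -> qsA A -> uok (UPos p A emp).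
Proof. by move=> okp l Ap hA; split=> //= l'; [lia|rewrite -l anc_id|lia]. Qed.

Lemma okB_parent p A B q r : okB p A B -> B r -> child q r -> m.+1 < len q -> B q.
Proof.
case=> [[s [_ _ _ ->]]|[_ _ h _ _]] Br c l; last exact: h Br c l.
case: Br => [d|d]; last by right; exact: desc_trans (desc_child c) d.
by case: (desc_parent d c) => [->|]; [right; exact: desc_child|left].
Qed.

Lemma uok_parent y q : uok y -> child q (up y) -> uok (lab (uA y) (uB y) q).
Proof.
move=> [okp A0 B0 hA hB] c; have lq := child_len c.
have okq := (child_ok c).1.
case: (leqP (len q) m) => [l|l]; first by rewrite lab0 //; exact: uok0.
have [Ay qA] := hA ltac:(lia).
move: l; rewrite leq_eqVlt => /orP[/eqP l|l].
  rewrite lab1 //; apply: uok1 => //.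
  by move: Ay; rewrite (anc_child c) ?l // anc_id.
have [bB By] := hB ltac:(lia).
rewrite lab2 //; split=> //= l'; [lia|lia| |].
  by rewrite -(anc_child c).
by rewrite -(anc_child c) //; split=> //; exact: okB_parent bB By c l.
Qed.

Lemma okB_child p A B q : qsA A -> okB p A B -> ok q -> B q -> exists2 r, child q r & B r.
Proof.
move=> [_ hA] [[s [_ _ _ ->]]|[_ hBA _ hI hII]] okq Bq.
  case: Bq => [d|d].
    have [r c] := pruned okq; exists r => //.
    by left; exact: desc_step d c.
  case: (desc_next d) => [e|[r c d']]; last by exists r => //; right.
  have [r c] := pruned okq; exists r => //.
  by left; rewrite -e; exact: desc_child.
have [ o|o] := pselect (odd (len q) = odd m); last exact: hII.
have [Aq _] := hBA _ Bq.
by have [r c Ar] := hA q okq Aq o; exists r => //; exact: hI Bq c o Ar.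
Qed.

Lemma uok2 p A B : ok p -> m.+1 < len p -> A (anc m.+1 p) -> qsA A ->
  okB (anc m.+2 p) A B -> B p -> uok (UPos p A B).
Proof. by move=> okp l Ap hA hB Bp; split=> //= l'; lia. Qed.

Lemma qsA_full : qsA (fun=> True).
Proof. by split=> // q okq _ _; have [r c] := pruned okq; exists r. Qed.

(** If [A] meets [O] at or after [p], a cone is a legal answer; otherwise the part of [A] after [p]
    already avoids [O]. *)
Lemma okB_ex p A : ok p -> A p -> len p = m.+2 -> qsA A -> exists2 B, okB p A B & B p.
Proof.
move=> okp Ap lp hA; have [[s [As Os d]]|h] := pselect (exists s, [/\ A s, O s & desc p s]).
  by exists (cone s); [left; exists s|right].
exists (between p A); last exact: between_refl.
right; split=> [|q Bq|q r Br c l|q r Bq c o Ar|q okq Bq o].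
- exact: between_refl.
- have Aq := between_holds Bq; split=> // Oq; apply: h; exists q; split=> //.
  by case: Bq.
- by apply: (between_parent Br c); rewrite lp.
- exact: between_step Bq c Ar.
- have [r c] := pruned okq; exists r => //; apply: (between_step Bq c).
  exact: hA.1 (between_holds Bq) c o.
Qed.

Definition utree : gtree.
Proof.
exists upos uok uchild (fun y => len (up y)).
- by move=> y z [].
- by move=> y z [_ _ /child_len].
- move=> [p A B] [p' A' B'] [q A1 B1] [[/= _ A0 B0 _ _] _ c eA eB].
  move=> [[/= _ A0' B0' _ _] _ c' eA' eB'].
  have e := child_inj c c'; rewrite -{}e in eA' eB' A0' B0' *; congr UPos.
    by case: (ltnP m (len p)) => l; [rewrite -eA // eA'|rewrite A0 // A0'].
  by case: (ltnP m.+1 (len p)) => l; [rewrite -eB // eB'|rewrite B0 // B0'].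
- move=> [p A B] y; have [/= okp A0 B0 hA hB] := y.
  case: (leqP (len p) m.+1) => [l|l]; last first.
    have [Ap qA] := hA ltac:(lia); have [bB Bp] := hB l.
    have [q c Bq] := okB_child qA bB okp Bp; exists (UPos q A B); split=> //=.
    by apply: uok2; rewrite ?(child_len c) ?(anc_child c) //; try lia; case: (child_ok c).
  move: l; rewrite leq_eqVlt => /orP[/eqP l|l].
    have [Ap qA] := hA ltac:(lia).
    rewrite -l anc_id in Ap; have [q c] := pruned okp.
    have okq := (child_ok c).2.
    have Aq : A q by apply: (qA.1 _ _ Ap c); rewrite l /=; case: (odd m).
    have lq : len q = m.+2 by rewrite (child_len c) l.
    have [B' bB' Bq'] := okB_ex okq Aq lq qA.
    exists (UPos q A B'); split=> //=; last lia.
    by apply: uok2; rewrite ?lq // -?lq ?anc_id // (anc_child c) -l ?anc_id //.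
  have [q c] := pruned okp; have okq := (child_ok c).2.
  have lq := child_len c.
  move: l; rewrite ltnS leq_eqVlt => /orP[/eqP l|l].
    (* A legal announcement at level [m] always exists: the full tree. *)
    exists (UPos q (fun=> True) emp); split=> //=; [|lia|lia].
    by apply: uok1 => //; [rewrite lq l|exact: qsA_full].
  by exists (UPos q emp emp); split=> //=; [apply: uok0 => //; lia|lia|lia].
- move=> y oky l; have [q c] := rooted (uok_ok oky) l.
  exists (lab (uA y) (uB y) q); split=> //=; first exact: uok_parent.
    by move=> ->.
  by move=> ->.
Defined.

Lemma lab_play x A B : play x -> A (x m.+1) -> qsA A -> okB (x m.+2) A B ->
  (forall n, m.+1 < n -> B (x n)) -> play (fun n => lab A B (x n) : utree).
Proof.
move=> px Ax hA hB Bx.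
have ul n : uok (lab A B (x n)).
  have okx := play_ok n px; have lx := play_len n px.
  case: (leqP n m) => [l|l]; first by rewrite lab0 ?lx //; apply: uok0; rewrite ?lx.
  move: l; rewrite leq_eqVlt => /orP[/eqP l|l].
    have lm : len (x n) = m.+1 by rewrite lx.
    by rewrite lab1 //; apply: uok1 => //; rewrite -l.
  rewrite lab2 ?lx //; apply: uok2; rewrite ?lx //; last exact: Bx.
    by rewrite play_anc // ltnW.
  by rewrite play_anc.
split=> [||n]; [exact: ul|exact: (play_len 0 px)|].
have lx := play_len n px.
split; [exact: ul|exact: ul|exact: play_child| |]; rewrite /= play_len // play_len //.
  by move=> l; rewrite l leqW.
by move=> l; rewrite l leqW.
Qed.

Lemma uchild_lab A B p (z : upos) : uchild (lab A B p) z -> len p <> m -> len p <> m.+1 ->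
  z = lab A B (up z).
Proof.
case: z => q A' B' [_ [/= _ A0 B0 _ _] /= c eA eB] n1 n2; have lq := child_len c.
rewrite /lab lq; congr UPos.
  case: (ltnP m (len p)) => l; last by rewrite A0 ?lq; [case: ifP => //; lia|lia].
  by rewrite eA // l leqW.
case: (ltnP m.+1 (len p)) => l; last by rewrite B0 ?lq; [case: ifP => //; lia|lia].
by rewrite eB // l leqW.
Qed.

(** Labels are inherited except at levels [m] and [m.+1], so only there must the move of [s] be
    matched together with its label. *)
Lemma lab_follows b (s : utree -> utree) x A B : strat b s -> play x ->
  play (fun n => lab A B (x n) : utree) ->
  (forall n, odd n = b -> n <> m -> n <> m.+1 -> x n.+1 = up (s (lab A B (x n)))) ->
  (odd m = b -> lab A B (x m.+1) = s (lab A B (x m))) ->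
  (odd m.+1 = b -> lab A B (x m.+2) = s (lab A B (x m.+1))) ->
  follows b s (fun n => lab A B (x n) : utree).
Proof.
move=> ss px pl h hm hm1 n o.
have [e|n1] := pselect (n = m); first by rewrite e; apply: hm; rewrite -e.
have [e|n2] := pselect (n = m.+1); first by rewrite e; apply: hm1; rewrite -e.
have lx := play_len n px.
have c : uchild (lab A B (x n)) (s (lab A B (x n))).
  by apply: ss; [exact: (play_ok n pl)|rewrite /= lx].
by rewrite [RHS](uchild_lab c) ?lx // -h.
Qed.

(** Before its tip is reached, the cone contains only one continuation, so [s] and [x] must make the
    same move. *)
Lemma cone_forced b (s : utree -> utree) x A n1 n : strat b s -> play x ->
  play (fun n => lab A (cone (x n1)) (x n) : utree) -> odd n = b ->
  m.+1 < n -> n < n1 -> x n.+1 = up (s (lab A (cone (x n1)) (x n))).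
Proof.
move=> ss px pl o l1 l2; have lx := play_len n px.
have [|_ ok2 c _ e] := ss _ (play_ok n pl); first by rewrite /= lx.
have lz := child_len c; rewrite /= lx in lz e c.
have [|_] := uok_B ok2; first by rewrite lz ltnW.
rewrite e //= l1 => -[d|d]; last by rewrite (play_desc_eq px d) lz.
have e' : x n1 = up (s (lab A (cone (x n1)) (x n))).
  by apply: (desc_len_eq d); rewrite lz play_len.
by rewrite -e' -[in RHS](play_len n1 px) e' lz.
Qed.

Lemma cone_play x n1 n : play x -> cone (x n1) (x n).
Proof.
by move=> px; case: (leqP n1 n) => l; [left|right]; apply: play_desc => //; exact: ltnW.
Qed.

(** * Pushing strategies down from the unraveled tree, and lifting plays *)

Definition base p : utree := UPos p emp emp.

(* The strategy of the announcing player: he forces a position of [A] in [O] whenever he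
   can, and then pretends that the opponent had exhibited it; as long as he cannot, he
   pretends that the opponent had answered with the positions of [A] where he cannot. *)
Definition targetI (s : utree -> utree) r :=
  [/\ ok r, m.+1 < len r, O r & uA (s (base (anc m r))) r].

Definition safeI (s : utree -> utree) A p :=
  between p (fun r => A r /\ ~ reach (odd m) (targetI s) r).

Definition pushI (s : utree -> utree) p : T :=
  if len p <= m then up (s (base p)) else
  let A := uA (s (base (anc m p))) in
  three_phase (odd m) m.+2 (targetI s) (fun r q => up (s (UPos q A (cone r))))
    (fun q => up (s (UPos q A (safeI s A (anc m.+2 q))))) p.

(* The strategy of the answering player: the positions worth reaching are those that [s]
   exhibits in answer to some announcement, which can then be pretended; as long as none
   can be forced, pretend that the announcement was exactly to prevent this. *)
Definition witII (s : utree -> utree) r A := (ok r /\ m.+1 < len r) /\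
  [/\ qsA A, A (anc m.+1 r), A r, O r &
      s (UPos (anc m.+1 r) A emp) = UPos (anc m.+2 r) A (cone r)].

Definition targetII (s : utree -> utree) r := exists A, witII s r A.

Definition safeII (s : utree -> utree) p :=
  between p (fun r => ~ reach (~~ odd m) (targetII s) r).

Definition hitII (s : utree -> utree) r q : T :=
  up (s (UPos q (pick_in emp (witII s r)) (cone r))).

(** At level [m.+1] the answer of [s] is still to be given; later it is recovered by asking [s]
    again at the ancestor of that level. *)
Definition stayII (s : utree -> utree) q : T :=
  let A := safeII s (anc m.+1 q) in
  if len q == m.+1 then up (s (UPos q A emp)) else
  let y := s (UPos (anc m.+1 q) A emp) in up (s (UPos q (uA y) (uB y))).

Definition pushII (s : utree -> utree) p : T :=
  if len p <= m then up (s (base p)) else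
  three_phase (~~ odd m) m.+1 (targetII s) (hitII s) (stayII s) p.

(** The attractor looks arbitrarily far ahead, but its target consults [s] only at level [m]. *)
Lemma pushI_local s s' p : ok p ->
  (forall y : utree, len y <= len p -> s y = s' y) -> pushI s p = pushI s' p.
Proof.
move=> okp h; rewrite /pushI; case: ifP => [l|/negbT]; first by rewrite h.
rewrite -ltnNge => l.
have eU : targetI s = targetI s'.
  apply/funext => r; apply/propext; split=> -[okr lr Or Ar]; split=> //.
    by rewrite -h //=; rewrite anc_len //; lia.
  by rewrite h //=; rewrite anc_len //; lia.
have -> : s (base (anc m p)) = s' (base (anc m p)).
  by apply: h => /=; rewrite anc_len // ltnW.
by rewrite /= eU; apply: three_phase_ext => [r|]; rewrite /safeI ?eU h.
Qed.

(** Here the targets of the attractor consult [s] only at level [m.+1]. *)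
Lemma pushII_local s s' p : ok p ->
  (forall y : utree, len y <= len p -> s y = s' y) -> pushII s p = pushII s' p.
Proof.
move=> okp h; rewrite /pushII; case: ifP => [l|/negbT]; first by rewrite h.
rewrite -ltnNge => l.
have eW : witII s = witII s'.
  apply/funext => r; apply/funext => A; apply/propext.
  have e : ok r /\ m.+1 < len r ->
      s (UPos (anc m.+1 r) A emp) = s' (UPos (anc m.+1 r) A emp).
    by move=> [okr lr]; apply: h => /=; rewrite anc_len //; lia.
  by split=> -[ol [? ? ? ? E]]; split=> //; split=> //; rewrite -E e.
have eU : targetII s = targetII s' by rewrite /targetII eW.
rewrite eU; apply: three_phase_ext => [r|]; first by rewrite /hitII eW h.
rewrite /stayII /safeII eU; case: ifP => _; first by rewrite h.
by rewrite [s (UPos (anc _ _) _ _)]h /= ?h //= anc_len.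
Qed.

(** The announcement [A] comes from [s]; the opponent's answer has to be invented. If no target can
    ever be forced along [x], the set [safeI] is a legal answer avoiding [O]; otherwise the answer
    is the cone of the target reached. *)
Lemma liftI s x : strat (odd m) s -> play x ->
  (forall n, odd n = odd m -> x n.+1 = fix_child (x n) (pushI s (x n))) ->
  exists x' : nat -> utree, [/\ play x', follows (odd m) s x' & forall n, up (x' n) = x n].
Proof.
move=> ss px fx.
have ok0 n : n <= m -> uok (base (x n)).
  by move=> l; apply: uok0; rewrite ?play_len //; exact: play_ok.
have s0 n : odd n = odd m -> n <= m -> uchild (base (x n)) (s (base (x n))).
  by move=> o l; apply: ss; [exact: ok0|rewrite /= play_len].
have f0 n : odd n = odd m -> n <= m -> x n.+1 = up (s (base (x n))).
  move=> o l; rewrite fx // /pushI play_len // l fix_child_id //.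
  by case: (s0 n o l).
set A := uA (s (base (x m))).
have xm1 := f0 m erefl (leqnn m).
have [_ okm1 cm1 _ _] := s0 m erefl (leqnn m).
have lm1 : len (up (s (base (x m)))) = m.+1 by rewrite -xm1 play_len.
have eB : uB (s (base (x m))) = emp by apply: (uok_B0 okm1); rewrite lm1.
have [Am1 qA] : A (x m.+1) /\ qsA A.
  have := uok_A okm1; rewrite lm1 -xm1 play_anc //.
  exact.
have Am2 : A (x m.+2).
  apply: (qA.1 _ _ Am1 (play_child _ px)); rewrite play_len //=.
  by case: (odd m).
have em1 B : lab A B (x m.+1) = s (lab A B (x m)).
  rewrite lab1 ?play_len // lab0 ?play_len // -/(base (x m)) /A.
  by move: xm1 eB; case: (s (base (x m))) => /= p A' B' -> ->.
have mm B : odd m.+1 = odd m -> lab A B (x m.+2) = s (lab A B (x m.+1)).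
  by move=> /=; case: (odd m).
have f2 n : m.+2 <= n -> odd n = odd m -> x n.+1 = fix_child (x n)
   (three_phase (odd m) m.+2 (targetI s) (fun r q => up (s (UPos q A (cone r))))
      (fun q => up (s (UPos q A (safeI s A (anc m.+2 q))))) (x n)).
  by move=> l o; rewrite fx // /pushI play_len // leqNgt ltnW ?(ltnW l) //= play_anc //; lia.
have key B : play (fun n => lab A B (x n) : utree) ->
    (forall n, odd n = odd m -> m.+1 < n -> x n.+1 = up (s (lab A B (x n)))) ->
    exists x' : nat -> utree, [/\ play x', follows (odd m) s x' & forall n, up (x' n) = x n].
  move=> pl h; exists (fun n => lab A B (x n)); split=> //.
  apply: (lab_follows ss px pl) => [n o n1 n2|_|]; [|exact: em1|exact: mm].
  case: (leqP n m) => l; last by apply: h => //; lia.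
  by rewrite lab0 ?play_len //; exact: f0.
case: (three_phaseP px f2) => [h|[n1 [n0 [ok1 l1 O1 A1] h]]].
  set p := x m.+2 in h.
  pose W := reach (odd m) (targetI s).
  pose B := safeI s A p.
  have okp : ok p by exact: play_ok.
  have Bp : B p by apply: between_refl; split=> //; exact: (h m.+2 _).1.
  have oB : okB p A B.
    right; split=> // [q Bq|q r Br c l|q r Bq c o Ar|q okq Bq o].
    (* A position of [A] in [O] after [p] would itself be a target. *)
    - have [Aq nW] := between_holds Bq; split=> // Oq; apply: nW; apply: reach_here.
      have [d _] := Bq; split=> //; first exact: desc_okr d.
        by have := desc_len d; rewrite play_len.
      suff -> : anc m q = x m by [].
      rewrite -{1}(play_len m px); apply: anc_desc.
      by apply: desc_trans d; apply: play_desc => //; lia.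
    - by apply: (between_parent Br c); rewrite play_len.
    - have [_ nW] := between_holds Bq.
      by apply: (between_step Bq c); split=> //; exact: reach_notown nW o c.
    - have [Aq nW] := between_holds Bq.
      have [r c nWr] := reach_notopp okq nW o; exists r => //.
      by apply: (between_step Bq c); split=> //; exact: qA.1 Aq c o.
  have okl n : m.+1 < n -> B (x n) -> uok (UPos (x n) A B).
    move=> l Bn; apply: uok2; rewrite ?play_len ?play_anc //; last exact: ltnW.
    exact: play_ok.
  have step n : m.+1 < n -> B (x n) -> odd n = odd m -> x n.+1 = up (s (UPos (x n) A B))
      /\ B (x n.+1).
    move=> l Bn o; have okn := okl n l Bn.
    have [|_ ok' c _ eB'] := ss _ okn; first by rewrite /= play_len.
    have e : x n.+1 = up (s (UPos (x n) A B)).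
      by rewrite (h n l).2 // play_anc // fix_child_id.
    split=> //; have [|_] := uok_B ok'; first by rewrite -e play_len // ltnW.
    by rewrite eB' /= ?play_len // -e.
  have Bx n : m.+1 < n -> B (x n).
    elim: n => // n IH; rewrite ltnS leq_eqVlt => /orP[/eqP <-//|l].
    have Bn := IH l; have [ o|o] := pselect (odd n = odd m); first by case: (step n l Bn o).
    have [An _] := between_holds Bn; apply: (between_step Bn (play_child n px)).
    split; last by apply: (h n.+1 _).1; exact: ltnW.
    by apply: (qA.1 _ _ An (play_child n px)); rewrite play_len.
  apply: (key B); first exact: lab_play.
  by move=> n o l; rewrite lab2 ?play_len //; case: (step n l (Bx n l) o).
have pl : play (fun n => lab A (cone (x n1)) (x n) : utree).
  apply: lab_play => // [|n _]; last exact: cone_play.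
  left; exists (x n1); split=> //; last exact: play_desc.
  by move: A1; rewrite play_anc //; lia.
apply: (key _ pl) => n o l; case: (ltnP n n1) => l1'; first exact: (cone_forced ss px pl).
rewrite h // lab2 ?play_len // fix_child_id //.
have := ss _ (play_ok n pl); rewrite /= play_len // lab2 ?play_len // => /(_ o).
by case.
Qed.

(** Now the opponent's announcement has to be invented and [s] supplies the answer. If no target can
    be forced along [x], the complement of the attractor is a quasi-strategy to announce; otherwise
    announce the witness of the target reached. *)
Lemma liftII s x : strat (~~ odd m) s -> play x ->
  (forall n, odd n = ~~ odd m -> x n.+1 = fix_child (x n) (pushII s (x n))) ->
  exists x' : nat -> utree, [/\ play x', follows (~~ odd m) s x' & forall n, up (x' n) = x n].
Proof.
move=> ss px fx.
have ok0 n : n <= m -> uok (base (x n)).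
  by move=> l; apply: uok0; rewrite ?play_len //; exact: play_ok.
have f0 n : odd n = ~~ odd m -> n <= m -> x n.+1 = up (s (base (x n))).
  move=> o l; rewrite fx // /pushII play_len // l fix_child_id //.
  by have [|_ _ c _ _] := ss _ (ok0 n l); first by rewrite /= play_len.
have lm1 : len (x m.+1) = m.+1 := play_len m.+1 px.
have okm1 : ok (x m.+1) := play_ok m.+1 px.
have f1 n : m.+1 <= n -> odd n = ~~ odd m -> x n.+1 = fix_child (x n)
   (three_phase (~~ odd m) m.+1 (targetII s) (hitII s) (stayII s) (x n)).
  by move=> l o; rewrite fx // /pushII play_len // leqNgt l.
have om1 : odd m.+1 = ~~ odd m by [].
have mm A B : odd m = ~~ odd m -> lab A B (x m.+1) = s (lab A B (x m)).
  by case: (odd m).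
have key A B : play (fun n => lab A B (x n) : utree) ->
    s (UPos (x m.+1) A emp) = UPos (x m.+2) A B ->
    (forall n, odd n = ~~ odd m -> m.+1 < n -> x n.+1 = up (s (lab A B (x n)))) ->
    exists x' : nat -> utree, [/\ play x', follows (~~ odd m) s x' & forall n, up (x' n) = x n].
  move=> pl e h; exists (fun n => lab A B (x n)); split=> //.
  apply: (lab_follows ss px pl) => [n o n1 n2||_]; [|exact: mm|]; last first.
    by rewrite (lab1 _ _ lm1) lab2 ?play_len.
  case: (leqP n m) => l; last by apply: h => //; lia.
  by rewrite lab0 ?play_len //; exact: f0.
case: (three_phaseP px f1) => [h|[n1 [n0 tn1 h]]].
  pose A := safeII s (x m.+1).
  have Am1 : A (x m.+1) by apply: between_refl; exact: (h m.+1 _).1.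
  have qA : qsA A.
    split=> [q r Aq c o|q okq Aq o].
      apply: (between_step Aq c); apply: reach_notown (between_holds Aq) _ c.
      by move: o; case: (odd m); case: (odd _).
    have [|r c nW] := reach_notopp okq (between_holds Aq).
      by rewrite o; case: (odd m).
    by exists r => //; exact: between_step Aq c nW.
  have ok1 : uok (UPos (x m.+1) A emp) by apply: uok1.
  have [|_ ok2 c eA _] := ss _ ok1; first by rewrite /= lm1.
  have e1 : x m.+2 = up (s (UPos (x m.+1) A emp)).
    rewrite (h m.+1 _).2 // /stayII lm1 eqxx play_anc // fix_child_id //.
  rewrite /= in c eA; have {}eA : uA (s (UPos (x m.+1) A emp)) = A.
    by apply: eA; rewrite lm1.
  pose B := uB (s (UPos (x m.+1) A emp)).
  have e2 : s (UPos (x m.+1) A emp) = UPos (x m.+2) A B.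
    by rewrite /B; move: e1 eA; case: (s (UPos (x m.+1) A emp)) => p A' B' /= -> ->.
  have [oB Bm2] : okB (x m.+2) A B /\ B (x m.+2).
    by have := uok_B ok2; rewrite e2 /= play_anc // play_len //; apply.
  (* If [s] answered with the cone of some [r], then [r] would be a target inside [A], which lies
     outside the attractor. *)
  have {oB} qB : qsB (x m.+2) A B.
    case: oB => // -[r [Ar Or d eB]]; case: (between_holds Ar); apply: reach_here.
    have lr := desc_len d; rewrite play_len // in lr.
    have d' : desc (x m.+1) r by apply: desc_trans d; exact: play_desc.
    have ar : anc m.+1 r = x m.+1 by rewrite -{1}lm1; exact: anc_desc.
    have ar2 : anc m.+2 r = x m.+2 by rewrite -{1}(play_len m.+2 px); exact: anc_desc.
    exists A; split; first by split=> //; exact: desc_okr d'.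
    by rewrite ar ar2 e2 eB.
  have [_ hBA _ hI _] := qB.
  have okl n : m.+1 < n -> B (x n) -> uok (UPos (x n) A B).
    move=> l Bn; apply: uok2; rewrite ?play_len ?play_anc //; try exact: ltnW.
      exact: play_ok.
    by right.
  have step n : m.+1 < n -> B (x n) -> odd n = ~~ odd m ->
      x n.+1 = up (s (UPos (x n) A B)) /\ B (x n.+1).
    move=> l Bn o; have okn := okl n l Bn.
    have [|_ ok' c' _ eB'] := ss _ okn; first by rewrite /= play_len.
    have e : x n.+1 = up (s (UPos (x n) A B)).
      rewrite (h n (ltnW l)).2 // /stayII play_len // play_anc ?(ltnW l) //.
      by rewrite -/A e2 gtn_eqF //= fix_child_id.
    split=> //; have [|_] := uok_B ok'; first by rewrite -e play_len // ltnW.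
    by rewrite eB' /= ?play_len // -e.
  have Bx n : m.+1 < n -> B (x n).
    elim: n => // n IH; rewrite ltnS leq_eqVlt => /orP[/eqP <-//|l].
    have Bn := IH l; have [ o|o] := pselect (odd n = ~~ odd m); first by case: (step n l Bn o).
    have [An _] := hBA _ Bn; apply: (hI _ _ Bn (play_child n px)).
      by rewrite play_len //; move: o; case: (odd n); case: (odd m).
    apply: (between_step An (play_child n px)).
    by apply: (h n.+1 _).1; exact: (leqW (ltnW l)).
  apply: (key A B) => //; first by apply: lab_play => //; right.
  by move=> n o l; rewrite lab2 ?play_len //; case: (step n l (Bx n l) o).
have [[okn1 ln1] [qA A1 A2 O1 e1]] := pick_inP emp tn1.
rewrite play_len // in ln1; rewrite !play_anc ?(ltnW ln1) // in A1 e1.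
set A := pick_in _ _ in qA A1 A2 e1.
have pl : play (fun n => lab A (cone (x n1)) (x n) : utree).
  apply: lab_play => // [|n _]; last exact: cone_play.
  by left; exists (x n1); split=> //; exact: play_desc.
apply: (key _ _ pl e1) => n o l; case: (ltnP n n1) => l1'.
  exact: (cone_forced ss px pl).
rewrite h // /hitII -/A lab2 ?play_len // fix_child_id //.
have := ss _ (play_ok n pl); rewrite /= play_len // lab2 ?play_len // => /(_ o).
by case.
Qed.

(* Normalising [s] outside the positions it governs makes locality an equality of
   functions. *)
Definition unorm b (s : utree -> utree) (y : utree) : utree :=
  if pselect (ok y /\ odd (len y) = b) then s y else y.

Definition upush b s p :=
  fix_child p ((if b == odd m then pushI else pushII) (unorm b s) p).

Lemma unormE b s y : ok y -> odd (len y) = b -> unorm b s y = s y.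
Proof. by move=> oky o; rewrite /unorm; case: pselect => // -[]. Qed.

Definition ucovering : covering utree T.
Proof.
exists (up : utree -> T) upush.
- by move=> y; case.
- by [].
- by move=> y z [].
- by move=> b s ss p okp o; exact: fix_childP.
- move=> b n s s' ss ss' a p okp o l; rewrite /upush.
  have h y : len y <= len p -> unorm b s y = unorm b s' y.
    move=> ly; rewrite /unorm; case: pselect => // -[oky oy] /=.
    by apply: a => //; exact: leq_ltn_trans ly l.
  by case: ifP => _; rewrite (pushI_local okp h, pushII_local okp h).
- move=> b s x ss px fx.
  have ss' : strat b (unorm b s) by move=> y oky o; rewrite unormE //; exact: ss.
  suff [x' [px' fx' e]] : exists x' : nat -> utree,
      [/\ play x', follows b (unorm b s) x' & forall n, up (x' n) = x n].
    exists x'; split=> // n o; rewrite fx' // unormE // ?play_len //.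
    exact: play_ok.
  have [e|ne] := eqVneq b (odd m).
    by rewrite {}e in fx ss' *; apply: liftI => // n o; rewrite fx // /upush eqxx.
  have {ne} e : b = ~~ odd m by move: ne; case: b {fx ss ss'}; case: (odd m).
  rewrite {}e in fx ss' *; apply: liftII => // n o; rewrite fx // /upush.
  by case: (odd m).
Defined.

Lemma ufixes : fixes m ucovering.
Proof.
split=> [[p A B] [q A' B'] [/= _ A0 B0 _ _] [/= _ A0' B0' _ _] l e|q okq l|b s [p A B] ss oky l o].
- rewrite -{}e in A0' B0' *; congr UPos; first by rewrite A0 // A0'.
  by rewrite B0 ?B0' // leqW.
- by exists (base q) => //; exact: uok0.
- have [/= okp A0 B0 _ _] := oky; rewrite /= in l.
  have eb : UPos p A B = base p by rewrite (A0 (ltnW l)) (B0 (leqW (ltnW l))).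
  rewrite {}eb in oky o *; rewrite /= /upush.
  have -> : (if b == odd m then pushI else pushII) (unorm b s) p = up (s (base p)).
    by rewrite -(unormE s oky o); case: ifP => _; rewrite /pushI /pushII ltnW.
  by apply: fix_child_id; case: (ss _ oky o).
Qed.

Hypothesis O_child : forall p q, child p q -> O p -> O q.

Lemma O_desc p q : desc p q -> O p -> O q.
Proof. by elim=> // q' r _ IH c /IH; exact: O_child. Qed.

(** A cone answer forces the play through its tip, which lies in [O]; a quasi-strategy answer
    confines the play outside [O] from level [m.+2] on, hence throughout since [O] is closed under
    descendants. *)
Lemma unravel_decided (x : nat -> utree) : play x ->
  (exists n, O (up (x n))) <-> exists2 s, uB (x m.+2) s & O s.
Proof.
move=> px; have pu : play (fun n => up (x n)) := cproj_play ucovering px.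
have l n : len (up (x n)) = n := play_len n pu.
have eB d : uB (x (d + m.+2)) = uB (x m.+2).
  elim: d => // d <-; have [_ _ _ _ ->] // := play_child (d + m.+2) px.
  by rewrite l; lia.
have okx n : uok (x n) := play_ok n px.
have [|oB _] := uok_B (okx m.+2); first by rewrite l.
have Bx n : m.+1 < n -> uB (x m.+2) (up (x n)).
  by move=> ln; rewrite -(eB (n - m.+2)) subnK //; case: (uok_B (okx n)) => //; rewrite l.
rewrite [anc _ _](play_anc pu (leqnn m.+2)) in oB.
case: oB => [[s [As Os d eBs]]|qB].
  split=> _; first by exists s => //; rewrite eBs; left; exact: desc_refl.
  (* At this level the play is confined to the cone and is at least as long as its tip. *)
  exists (maxn m.+2 (len s)); apply: O_desc Os.
  have := Bx (maxn m.+2 (len s)); rewrite leq_max ltnSn eBs => /(_ isT) -[//|d'].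
  have e := desc_len_eq d'; rewrite l leq_maxr in e.
  by rewrite e //; exact: desc_refl.
have [_ hB _ _ _] := qB; split=> [[n On]|[s Bs Os]]; last by case: (hB s Bs).
exists (up (x (maxn m.+2 n))); first by apply: Bx; rewrite leq_max ltnSn.
by apply: O_desc On; apply: (play_desc pu); exact: leq_maxr.
Qed.

End Unravel.

(** * Borel determinacy *)

Section Unravelable.
Variable Z : Type.
Implicit Type X : set (nat -> Z).

(* [unravels] asks for a decision at a fixed level, which is more than being clopen. *)
Definition unravels (T' T : gtree) (C : covering T' T) (h : T -> Z) X :=
  exists n (D : T' -> Prop), forall x, play x -> X (fun k => h (C (x k))) <-> D (x n).

(** The labelling [h] lets the same set be pulled back to any covering tree; an arbitrary [m] is
    required to build inverse limits. *)
Definition unravelable X := forall (T : gtree) (h : T -> Z) m,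
  exists (T' : gtree) (C : covering T' T), fixes m C /\ unravels C h X.

Lemma unravelable_finite N X :
  (forall z z', (forall k, k <= N -> z k = z' k) -> X z -> X z') -> unravelable X.
Proof.
move=> hX T h m; exists T, (id_covering T); split; first exact: id_fixes.
exists N, (fun p => X (fun k => h (anc k p))) => x px /=.
by split; apply: hX => k kN; rewrite play_anc.
Qed.

Lemma unravelableC X : unravelable X -> unravelable (~` X).
Proof.
move=> uX T h m; have [T' [C [fC [n [D hD]]]]] := uX T h m.
exists T', C; split=> //; exists n, (fun p => ~ D p) => x px.
by split=> hn; apply: contra_not hn; apply hD.
Qed.

Section Union.
Variables (X : nat -> set (nat -> Z)) (uX : forall i, unravelable (X i)) (m : nat).

Let stage := {T : gtree & T -> Z}.

Let next i (S : stage) : {T' : gtree & {C : covering T' (projT1 S) |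
  fixes (m + i) C /\ unravels C (projT2 S) (X i)}}.
Proof.
by have /cid[T' /cid[C hC]] := uX i (projT2 S) (m + i); exists T', C.
Defined.

Let stages (S0 : stage) := fix f i : stage :=
  if i is i'.+1 then
    let N := next i' (f i') in
    existT (fun T : gtree => T -> Z) (projT1 N) (projT2 (f i') \o sval (projT2 N))
  else S0.

(** Unravel the sets [X i] one after another, fixing level [m + i] at stage [i], and take the
    inverse limit. There every [X i] is decided at a finite level, so the union is open, and one
    more unraveling decides it. *)
Lemma unravelable_bigcup_at (T : gtree) (h : T -> Z) :
  exists (T' : gtree) (C : covering T' T), fixes m C /\ unravels C h (\bigcup_i X i).
Proof.
pose S := stages (existT (fun T : gtree => T -> Z) T h).
pose TT i := projT1 (S i); pose hh i : TT i -> Z := projT2 (S i).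
pose CC i : covering (TT i.+1) (TT i) := sval (projT2 (next i (S i))).
have fCC i : fixes (m + i) (CC i) := proj1 (svalP (projT2 (next i (S i)))).
have uCC i : unravels (CC i) (hh i) (X i) := proj2 (svalP (projT2 (next i (S i)))).
have hhS i y : hh i.+1 y = hh i (CC i y) by [].
pose L := lim_tree fCC.
pose nD i := cid (uCC i); pose n i := projT1 (nD i).
pose D i := projT1 (cid (projT2 (nD i))).
have hD i x : play x -> X i (fun k => hh i (CC i (x k))) <-> D i (x (n i)).
  exact: (projT2 (cid (projT2 (nD i)))).
have XD i (x : nat -> L) : play x -> X i (fun k => h (x k 0)) <-> D i (x (n i) i.+1).
  move=> px; rewrite -(hD i _ (lim_proj_play i.+1 px)).
  suff -> : (fun k => hh i (CC i (x k i.+1))) = (fun k => h (x k 0)) by [].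
  apply/funext => k; have ck := play_ok k px.
  have e j : hh j (x k j) = h (x k 0).
    by elim: j => // j <-; rewrite hhS (proj2 ck).
  by rewrite (proj2 ck) e.
(* A position is in [O] once some [X i] has been decided positively. *)
pose O (p : L) := exists i, n i <= len p /\ D i ((anc (n i) p : L) i.+1).
have Oup (p q : L) : child p q -> O p -> O q.
  move=> c [i [l Di]]; exists i; rewrite (anc_child c) //; split=> //.
  by rewrite (child_len c) leqW.
exists (utree m O), (comp_covering (ucovering m O) (lim_covering fCC)); split.
  by apply: comp_fixes; [exact: ufixes|exact: lim_fixes].
exists m.+2, (fun y : utree m O => exists2 s, uB y s & O s) => x px.
rewrite -(unravel_decided Oup px).
have pu : play (fun k => up (x k)) := cproj_play (ucovering m O) px.
split=> [[i _ /(XD i _ pu) Di]|[k [i [l Di]]]].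
  exists (n i), i; rewrite (play_len (n i) pu); split=> //.
  by rewrite [anc _ _](play_anc pu (leqnn (n i))).
exists i => //; apply/(XD i _ pu).
by move: Di; rewrite (play_len k pu) in l; rewrite [anc _ _](play_anc pu l).
Qed.

End Union.

Lemma unravelable_bigcup (X : nat -> set (nat -> Z)) :
  (forall i, unravelable (X i)) -> unravelable (\bigcup_i X i).
Proof. by move=> uX T h m; exact: unravelable_bigcup_at. Qed.

(** In the covering the winner is known at level [n]: either [b] can force a winning position of
    that level, or the opponent can stay outside the attractor. The winning strategy is pushed
    down. *)
Lemma unravelable_determined X (T : gtree) (h : T -> Z) b (r : T) :
  unravelable X -> ok r -> len r = 0 ->
  (exists s, strat b s /\
     forall x, play x -> x 0 = r -> follows b s x -> X (fun k => h (x k))) \/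
  (exists s, strat (~~ b) s /\
     forall x, play x -> x 0 = r -> follows (~~ b) s x -> ~ X (fun k => h (x k))).
Proof.
(* Fixing level 0 gives the root [r] a unique lift. *)
move=> uX okr lr; have [T' [C [fC [n [D hD]]]]] := uX T h 0.
have [r' okr' er'] : exists2 r', ok r' & C r' = r by apply: (fixes_surj fC) => //; rewrite lr.
have root x' : play x' -> C (x' 0) = r -> x' 0 = r'.
  move=> px' e; apply: (fixes_inj fC) => //; [exact: play_ok|by rewrite play_len|].
  by rewrite e.
pose U (p : T') := len p = n /\ D p.
have [W|W] := pselect (reach b U r').
  left; have [s [ss hs]] := reach_strat W; exists (cpush C b s).
  split; first exact: cpush_strat.
  move=> x px x0 fx; have [x' [px' fx' e]] := cpush_lift ss px fx.
  have -> : x = C \o x' by apply/funext => k /=.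
  have [|k _ [lk Dk]] := hs x' 0 px' (root x' px' _) (fun k _ _ o => fx' k o).
    by rewrite e.
  by apply/(hD x' px'); move: lk Dk; rewrite play_len // => ->.
right; pose s p := if pselect (exists q, child p q /\ ~ reach b U q)
  then pick_in p (fun q => child p q /\ ~ reach b U q) else succ p.
have ss : strat (~~ b) s.
  move=> p okp _; rewrite /s; case: pselect => [ex|_] /=; last exact: succP.
  by case: (pick_inP p ex).
exists (cpush C (~~ b) s); split; first exact: cpush_strat.
move=> x px x0 fx; have [x' [px' fx' e]] := cpush_lift ss px fx.
have -> : x = C \o x' by apply/funext => k /=.
have nW k : ~ reach b U (x' k).
  elim: k => [|k IH]; first by rewrite root // e.
  have lk := play_len k px'; have okk := play_ok k px'.
  have [ o|o] := pselect (odd k = b).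
    by apply: (reach_notown IH _ (play_child k px')); rewrite lk.
  rewrite fx'; last by move: o; case: b {ss s fx fx' W IH}; case: (odd k).
  have [|q c nq] := reach_notopp okk IH; first by rewrite lk.
  have ex : exists q, child (x' k) q /\ ~ reach b U q by exists q.
  by rewrite /s; case: pselect => // ? /=; case: (pick_inP (x' k) ex).
move=> /(hD x' px') Dn; apply: (nW n); apply: reach_here; split=> //.
by rewrite play_len.
Qed.

End Unravelable.

(** * Determinacy of the concrete negotiation game *)

Section UnravelableClosure.
Variable Z : Type.
Implicit Types P Q : (nat -> Z) -> Prop.

Lemma unravelable_not P : unravelable P -> unravelable (fun z => ~ P z).
Proof. exact: unravelableC. Qed.

Lemma unravelable_exists (I : countType) (P : I -> (nat -> Z) -> Prop) :
  (forall i, unravelable (P i)) -> unravelable (fun z => exists i, P i z).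
Proof.
move=> uP; pose X n : set (nat -> Z) := fun z => if unpickle n is Some i then P i z else False.
have uX n : unravelable (X n).
  rewrite /X; case: (unpickle n) => [i|]; first exact: uP.
  by apply: (@unravelable_finite _ 0).
suff -> : (fun z => exists i, P i z) = \bigcup_n X n by exact: unravelable_bigcup.
apply/funext => z; apply/propext; split=> [[i Pi]|[n _]].
  by exists (pickle i) => //; rewrite /X pickleK.
by rewrite /X; case: (unpickle n) => // i Pi; exists i.
Qed.

Lemma unravelable_forall (I : countType) (P : I -> (nat -> Z) -> Prop) :
  (forall i, unravelable (P i)) -> unravelable (fun z => forall i, P i z).
Proof.
move=> uP.
have -> : (fun z => forall i, P i z) = (fun z => ~ exists i, ~ P i z).
  apply/funext => z; apply/propext; split=> [h [i]|h i]; first exact.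
  by apply: contrapT => ni; apply: h; exists i.
by apply/unravelable_not/unravelable_exists => i; exact: unravelable_not.
Qed.

Lemma unravelable_or P Q : unravelable P -> unravelable Q -> unravelable (fun z => P z \/ Q z).
Proof.
move=> uP uQ.
have -> : (fun z => P z \/ Q z) = (fun z => exists b : bool, (if b then P else Q) z).
  apply/funext => z; apply/propext; split=> [[]|[[]]].
  - by exists true.
  - by exists false.
  - by left.
  - by right.
by apply: unravelable_exists; case.
Qed.

Lemma unravelable_and P Q : unravelable P -> unravelable Q -> unravelable (fun z => P z /\ Q z).
Proof.
move=> uP uQ.
have -> : (fun z => P z /\ Q z) = (fun z => forall b : bool, (if b then P else Q) z).
  apply/funext => z; apply/propext; split=> [[? ?] []//|h].
  by split; [exact: (h true)|exact: (h false)].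
by apply: unravelable_forall; case.
Qed.

End UnravelableClosure.

(** * The concrete negotiation game as a game tree *)

Section Conc.
Variables (Pi V : finType) (E : rel V) (owner : V -> Pi) (i : Pi) (s0 : cstate V).
Hypotheses (hE : forall v : V, exists w : V, E v w) (s0P : is_prover s0).
Local Notation edge := (conc_edge E owner i).

Definition cok (p : seq (cstate V)) := exists t, p = s0 :: t /\ path edge s0 t.

Definition cchild (p q : seq (cstate V)) :=
  cok p /\ exists2 s, edge (last s0 p) s & q = rcons p s.

Lemma cok_rcons p s : cok p -> edge (last s0 p) s -> cok (rcons p s).
Proof.
move=> [t [-> pt]] /= e; exists (rcons t s); split=> //.
by rewrite rcons_path pt.
Qed.

Lemma edge_ex s : exists s', edge s s'.
Proof.
case: s => [v M|u v M] /=; last by exists (PState v (v |: M)%SET); rewrite !eqxx.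
by have [w e] := hE v; exists (CState v w M); rewrite !eqxx e.
Qed.

(** Positions are histories from [s0]. Subtracting one from the size puts the root at level 0, so
    Prover owns the even levels and Challenger the odd ones. *)
Definition ctree : gtree.
Proof.
exists (seq (cstate V)) cok cchild (fun p => (size p).-1).
- by move=> p q [okp [s e ->]]; split=> //; exact: cok_rcons.
- by move=> p q [[t [-> _]] [s _ ->]]; rewrite size_rcons.
- by move=> p p' q [_ [s _ ->]] [_ [s' _ /rcons_inj[]]].
- move=> p okp; have [s e] := edge_ex (last s0 p).
  by exists (rcons p s); split=> //; exists s.
- move=> q [t [-> pt]] /=; case/lastP: t pt => // t s; rewrite rcons_path => /andP[pt e] _.
  by exists (s0 :: t); split; [exists t|exists s].
Defined.

Lemma edge_prover s s' : edge s s' -> is_prover s' = ~~ is_prover s.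
Proof. by case: s s' => [? ?|? ? ?] [? ?|? ? ?]. Qed.

Lemma cok_prover (p : ctree) : ok p -> is_prover (last s0 p) = ~~ odd (len p).
Proof.
move=> [t [-> pt]] /=; elim/last_ind: t pt => // t s IH.
rewrite rcons_path last_rcons size_rcons => /andP[/IH {}IH /edge_prover ->].
by rewrite /= IH.
Qed.

Lemma chist_play tauP tauC : prover_strat E owner i s0 tauP ->
  challenger_strat E owner i s0 tauC -> play (chist tauP tauC s0 : nat -> ctree).
Proof.
move=> hP hC.
have c n : cok (chist tauP tauC s0 n) ->
    cchild (chist tauP tauC s0 n) (chist tauP tauC s0 n.+1).
  move=> okn; split=> //=; eexists; last reflexivity.
  have [t [-> pt]] := okn; rewrite /=; case: ifP => h; first exact: hP.
  by apply: hC => //; rewrite h.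
have okn n : cok (chist tauP tauC s0 n).
  elim: n => [|n IH]; first by exists [::].
  by have [_ [s e ->]] := c n IH; exact: cok_rcons.
by split=> [|//|n]; [exact: (okn 0)|exact/c/okn].
Qed.

Lemma conc_determined X : unravelable X ->
  (exists2 tauC, challenger_strat E owner i s0 tauC &
     forall tauP, prover_strat E owner i s0 tauP -> X (coutcome tauP tauC s0)) \/
  (exists2 tauP, prover_strat E owner i s0 tauP &
     forall tauC, challenger_strat E owner i s0 tauC -> ~ X (coutcome tauP tauC s0)).
Proof.
move=> uX.
have okr : ok ([:: s0] : ctree) by exists [::].
have toP (s : ctree -> ctree) : strat false s -> prover_strat E owner i s0 (fun p => last s0 (s p)).
  move=> ss t pt pr; have okt : ok (s0 :: t : ctree) by exists t.
  have [|_ [s' e ->]] := ss _ okt; last by rewrite last_rcons.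
  by apply: negbTE; rewrite -cok_prover.
have toC (s : ctree -> ctree) : strat true s -> challenger_strat E owner i s0 (fun p => last s0 (s p)).
  move=> ss t pt pr; have okt : ok (s0 :: t : ctree) by exists t.
  have [|_ [s' e ->]] := ss _ okt; last by rewrite last_rcons.
  by apply: negbNE; rewrite -cok_prover.
have pick (s : ctree -> ctree) b (p : ctree) : strat b s -> ok p -> odd (len p) = b ->
    s p = rcons p (last s0 (s p)).
  by move=> ss okp o; have [_ [s' _ ->]] := ss p okp o; rewrite last_rcons.
have [[s [ss hs]]|[s [ss hs]]] :=
  unravelable_determined (last s0 : ctree -> cstate V) true uX okr erefl.
  left; exists (fun p => last s0 (s p)); first exact: toC.
  move=> tauP hP; have px := chist_play hP (toC _ ss).
  apply: (hs _ px) => // n o; rewrite (pick _ true) //; last by rewrite play_len.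
    by rewrite /= (cok_prover (play_ok n px)) play_len // o.
  exact: play_ok.
right; exists (fun p => last s0 (s p)); first exact: toP.
move=> tauC hC; have px := chist_play (toP _ ss) hC.
apply: (hs _ px) => // n o; rewrite (pick _ false) //; last by rewrite play_len.
  by rewrite /= (cok_prover (play_ok n px)) play_len // o.
exact: play_ok.
Qed.

Lemma coutcome_path tauP tauC n : prover_strat E owner i s0 tauP ->
  challenger_strat E owner i s0 tauC ->
  edge (coutcome tauP tauC s0 n) (coutcome tauP tauC s0 n.+1).
Proof.
move=> hP hC; have [_ [s e]] := play_child n (chist_play hP hC).
by rewrite /coutcome => ->; rewrite last_rcons.
Qed.

Lemma coutcome_prover tauP tauC n : prover_strat E owner i s0 tauP ->
  challenger_strat E owner i s0 tauC -> is_prover (coutcome tauP tauC s0 n) = ~~ odd n.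
Proof.
move=> hP hC; have px := chist_play hP hC.
by rewrite (cok_prover (play_ok n px)) play_len.
Qed.

Lemma edge_vertex s1 s2 s3 : is_prover s1 -> edge s1 s2 -> edge s2 s3 ->
  E (cvertex s1) (cvertex s3).
Proof.
case: s1 => // v M _; case: s2 => // v' w M' /and3P[/eqP -> e _].
by case: s3 => // w' M2 /orP[/andP[/eqP -> _]|/and4P[_ e' _ _]].
Qed.

Lemma projection_play tauP tauC : prover_strat E owner i s0 tauP ->
  challenger_strat E owner i s0 tauC -> is_play E (projection (coutcome tauP tauC s0)).
Proof.
move=> hP hC n; rewrite /projection.
apply: (@edge_vertex _ (coutcome tauP tauC s0 (2 * n).+1)).
- by rewrite coutcome_prover // mul2n odd_double.
- exact: coutcome_path.
- by rewrite mulnS; exact: coutcome_path.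
Qed.

End Conc.

Lemma ereal_between (R : realType) (x y : \bar R) : (x < y)%E ->
  exists c : R, (x < c%:E < y)%E.
Proof.
case: x y => [x||] [y||] //; rewrite ?lte_fin => xy.
- by exists ((x + y) / 2)%R; rewrite !lte_fin !(midf_lt xy).
- by exists (x + 1)%R; rewrite lte_fin ltrDl ltr01 ltry.
- by exists (y - 1)%R; rewrite lte_fin gtrDl ltrN10 ltNyr.
- by exists 0%R; rewrite ltNyr ltry.
Qed.

(** * Borel payoffs and equality of the lower and upper values *)

Section Value.
Variables (R : realType) (Pi V : finType) (E : rel V) (owner : V -> Pi).
Variable mu : (nat -> V) -> Pi -> R.
Hypotheses (hE : forall v : V, exists w : V, E v w).
Hypotheses (hBorel : borel_payoff mu) (hPI : prefix_independent E mu).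

Lemma mu_suffix rho n : is_play E rho -> mu (Defs.suffix rho n) = mu rho.
Proof.
move=> pr; have e : prepend (mkseq rho n) (Defs.suffix rho n) = rho.
  apply/funext => k; rewrite /prepend size_mkseq; case: ltnP => l.
    by rewrite nth_mkseq.
  by rewrite /Defs.suffix subnKC.
rewrite -{2}e; apply/esym/hPI; last by rewrite e.
by move=> k; rewrite /Defs.suffix addnS.
Qed.

(** The sets whose preimage under [projection] is unravelable form a sigma-algebra containing the
    open sets. *)
Lemma unravelable_borel (A : set (nat -> V)) : seq_borel A ->
  unravelable (fun z : nat -> cstate V => A (projection z)).
Proof.
move=> bA.
apply: (bA [set B | unravelable (fun z : nat -> cstate V => B (projection z))]).
split=> [|U oU] /=; last first.
  (* An open set is the union over [N] of the sets where the first [N] vertices certify membership;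
     these vertices sit at even times below [2 * N]. *)
  have -> : (fun z : nat -> cstate V => U (projection z)) =
     (fun z => exists N : nat, forall rho', (forall k, (k < N)%N -> rho' k = projection z k) -> U rho').
    apply/funext => z; apply/propext; split=> [/oU//|[N h]].
    exact: h.
  apply: unravelable_exists => N; apply: (@unravelable_finite _ (2 * N)).
  move=> z z' e h rho' e'; apply: h => k kN; rewrite e' // /projection e //.
  by rewrite leq_mul2l ltnW.
split=> [|B hB|F hF].
- exact: (@unravelable_finite _ 0).
- rewrite setTD; exact: unravelable_not.
- rewrite /=; set G := (X in unravelable X).
  have -> : G = (fun z => exists k, F k (projection z)).
    by apply/funext => z; apply/propext; split=> [[k _ Fk]|[k Fk]]; exists k.
  exact: unravelable_exists.
Qed.

Lemma unravelable_gt (c : R) j :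
  unravelable (fun z : nat -> cstate V => (c < mu (projection z) j)%R).
Proof. exact: (unravelable_borel (hBorel j (@open_gt R c))). Qed.

Lemma unravelable_lt (c : R) j :
  unravelable (fun z : nat -> cstate V => (mu (projection z) j < c)%R).
Proof. exact: (unravelable_borel (hBorel j (@open_lt R c))). Qed.

Lemma unravelable_le (c : \bar R) j :
  unravelable (fun z : nat -> cstate V => (c <= (mu (projection z) j)%:E)%E).
Proof.
case: c => [c||].
- have -> : (fun z : nat -> cstate V => (c%:E <= (mu (projection z) j)%:E)%E : Prop) =
      (fun z => ~ (mu (projection z) j < c)%R).
    apply/funext => z; rewrite lee_fin leNgt; apply/propext.
    by split=> /negP.
  exact/unravelable_not/unravelable_lt.
- by apply: (@unravelable_finite _ 0).
- by apply: (@unravelable_finite _ 0) => z z' _ _; rewrite leNye.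
Qed.

Local Open Scope ereal_scope.
Variables (lam : requirement R V) (i : Pi).

(* On plays this is [nuC z > c], with prefix independence used to replace the payoffs
   of all suffixes by that of the whole play. *)
Definition beats (c : R) (z : nat -> cstate V) : Prop :=
  (exists n, (forall k, (2 * n <= k)%N -> ~ is_deviation (z k) (z k.+1)) /\
     exists k v, (cvertex (z (2 * (n + k))%N) = v /\
       ~ (lam v <= (mu (projection z) (owner v))%:E))) \/
  (c < mu (projection z) i)%R.

Lemma unravelable_beats c : unravelable (beats c).
Proof.
apply: unravelable_or; last exact: unravelable_gt.
apply: unravelable_exists => n; apply: unravelable_and.
  apply: unravelable_forall => k.
  apply: (@unravelable_finite _ k.+1) => z z' e h l.
  by rewrite -!e //; exact: h.
apply: unravelable_exists => k; apply: unravelable_exists => v.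
apply: unravelable_and; last exact/unravelable_not/unravelable_le.
by apply: (@unravelable_finite _ (2 * (n + k))) => z z' e <-; rewrite e.
Qed.

Lemma beatsE c z : is_play E (projection z) ->
  beats c z <-> c%:E < nuC owner mu lam i z.
Proof.
move=> pz.
have h n : lconsistent owner mu lam (Defs.suffix (projection z) n) <->
    forall k, lam (projection z (n + k)%N) <=
       (mu (projection z) (owner (projection z (n + k)%N)))%:E.
  have e k : mu (Defs.suffix (Defs.suffix (projection z) n) k) = mu (projection z).
    have -> : Defs.suffix (Defs.suffix (projection z) n) k = Defs.suffix (projection z) (n + k).
      by apply/funext => l; rewrite /Defs.suffix addnA.
    exact: mu_suffix.
  split=> [hc k|hc j k <-]; first by have := hc _ k erefl; rewrite e.
  by rewrite e; exact: hc.
rewrite /nuC /beats; case: pselect => [[n [hd hn]]|hn] /=.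
  split=> [_|_]; first by rewrite ltry.
  left; exists n; split=> [k|]; first by move/hd/negP.
  apply: contrapT => hk; apply: hn; apply/h => k; apply: contrapT => nk.
  by apply: hk; exists k, (projection z (n + k)).
rewrite lte_fin; split=> [[[n [hd [k [v [ev nv]]]]]|//]|]; last by right.
case: hn; exists n; split=> [k'|]; first by move/hd/negP.
by move=> /h/(_ k); rewrite /projection ev.
Qed.

(** A real [c] strictly between the two values is refuted by determinacy of [beats c]: whoever wins
    guarantees a bound contradicting the choice of [c]. *)
Lemma conc_value s0 : is_prover s0 ->
  conc_lower_val E owner mu lam i s0 = conc_upper_val E owner mu lam i s0.
Proof.
move=> s0P; apply/eqP; rewrite eq_le; apply/andP; split.
  apply: ge_ereal_sup => _ [tauC hC <-]; apply: le_ereal_inf_tmp => _ [tauP hP <-].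
  apply: (@le_trans _ _ (nuC owner mu lam i (coutcome tauP tauC s0))).
    by apply: ereal_inf_lbound; exists tauP.
  by apply: ereal_sup_ubound; exists tauC.
rewrite leNgt; apply/negP => lt.
have [c /andP[c1 c2]] : exists c : R,
    conc_lower_val E owner mu lam i s0 < c%:E < conc_upper_val E owner mu lam i s0.
  exact: ereal_between.
have [[tauC hC h]|[tauP hP h]] := conc_determined owner i hE s0P (unravelable_beats c).
  move: c1; rewrite ltNge => /negP; apply.
  apply: (@le_trans _ _ (ereal_inf [set nuC owner mu lam i (coutcome tauP tauC s0)
                           | tauP in prover_strat E owner i s0])); last first.
    by apply: ereal_sup_ubound; exists tauC.
  apply: le_ereal_inf_tmp => _ [tauP hP <-]; apply/ltW/beatsE; last exact: h.
  exact: (projection_play hE s0P hP hC).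
move: c2; rewrite ltNge => /negP; apply.
apply: (@le_trans _ _ (ereal_sup [set nuC owner mu lam i (coutcome tauP tauC s0)
                           | tauC in challenger_strat E owner i s0])).
  by apply: ereal_inf_lbound; exists tauP.
apply: ge_ereal_sup => _ [tauC hC <-]; rewrite leNgt; apply/negP => /beatsE hb.
apply: (h tauC hC); apply: hb.
exact: (projection_play hE s0P hP hC).
Qed.

End Value.

(** * Prover strategies and rational profiles *)

Lemma mkseq_cat (A : Type) (rho : nat -> A) m n :
  mkseq rho m ++ mkseq (fun k => rho (m + k)%N) n = mkseq rho (m + n).
Proof.
rewrite /mkseq iotaD map_cat; congr cat.
by rewrite add0n -[in RHS](addn0 m) iotaDl -map_comp.
Qed.

Lemma last_mkseq (A : Type) (x : A) rho n : last x (mkseq rho n.+1) = rho n.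
Proof. by rewrite mkseqS last_rcons. Qed.

Lemma take_mkseq (A : Type) (rho : nat -> A) k n : (k <= n)%N ->
  take k (mkseq rho n) = mkseq rho k.
Proof. by move=> kn; rewrite /mkseq -map_take take_iota (minn_idPl kn). Qed.

Section Outcome.
Variables (Pi V : finType) (E : rel V) (owner : V -> Pi).

Lemma ohist_mkseq (P : profile Pi V) v n :
  ohist owner P v n = mkseq (outcome owner P v) n.+1.
Proof. by elim: n => // n IH; rewrite mkseqS -IH /= /outcome /= last_rcons. Qed.

Lemma outcomeS (P : profile Pi V) v n : outcome owner P v n.+1 =
  P (owner (outcome owner P v n)) (mkseq (outcome owner P v) n.+1).
Proof. by rewrite {1}/outcome /= last_rcons ohist_mkseq last_mkseq. Qed.

Lemma outcome_unique (P : profile Pi V) rho :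
  (forall n, rho n.+1 = P (owner (rho n)) (mkseq rho n.+1)) ->
  outcome owner P (rho 0) = rho.
Proof.
move=> h; apply/funext => n.
suff e : ohist owner P (rho 0) n = mkseq rho n.+1 by rewrite /outcome e last_mkseq.
by elim: n => // n IH; rewrite /= IH last_mkseq -h -mkseqS.
Qed.

Lemma shift_mkseq (P : profile Pi V) rho n j h :
  Defs.shift P (mkseq rho n.+1) j h = P j (mkseq rho n ++ h).
Proof.
rewrite /Defs.shift mkseqS; case e : (mkseq rho n) => [|x t] //=.
by rewrite belast_rcons.
Qed.

Lemma mkseq_path rho n : is_play E rho -> path E (rho 0) (behead (mkseq rho n.+1)).
Proof.
move=> pr; elim: n => // n IH; rewrite mkseqS.
have -> : behead (rcons (mkseq rho n.+1) (rho n.+1)) =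
  rcons (behead (mkseq rho n.+1)) (rho n.+1) by [].
have l : last (rho 0) (behead (mkseq rho n.+1)) = rho n.
  by rewrite -[RHS](last_mkseq (rho 0) rho n).
by rewrite rcons_path IH l pr.
Qed.

Lemma history_mkseq rho n : is_play E rho -> history_from E (rho 0) (mkseq rho n.+1).
Proof. by move=> pr; exists (behead (mkseq rho n.+1)); split=> //; exact: mkseq_path. Qed.

(** Used to realise a play compatible with the coalition as a response of player [i]; falling back
    on [s] off the play keeps every move legal. *)
Definition follow_play rho (s : strategy V) : strategy V :=
  fun h => if h == mkseq rho (size h) then rho (size h) else s h.

Lemma follow_play_strat j rho s : is_play E rho -> strat_from E owner j (rho 0) s ->
  strat_from E owner j (rho 0) (follow_play rho s).
Proof.
move=> pr ss t pt o; rewrite /follow_play /=; case: eqP => [e|_]; last exact: ss.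
have -> : last (rho 0) t = rho (size t).
  by rewrite -(last_mkseq (rho 0) rho (size t)) -e.
exact: pr.
Qed.

Definition compatible_play i (sig : profile Pi V) rho :=
  forall n, owner (rho n) != i -> rho n.+1 = sig (owner (rho n)) (mkseq rho n.+1).

Lemma outcome_follow_play i sig rho s : compatible_play i sig rho ->
  outcome owner (upd sig i (follow_play rho s)) (rho 0) = rho.
Proof.
move=> h; apply: outcome_unique => n; rewrite /upd; case: eqVneq => [_|ni]; last exact: h.
by rewrite /follow_play size_mkseq eqxx.
Qed.

Lemma compatible_mkseq i sig rho n : compatible_play i sig rho ->
  compatible owner i sig (rho 0) (mkseq rho n.+1).
Proof.
move=> h k; rewrite size_mkseq ltnS => kn; rewrite !nth_mkseq //; last exact: ltnW.
move=> /h ->; congr (sig _ _).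
by rewrite take_mkseq // ltnW.
Qed.

Lemma outcome_shift (P : profile Pi V) rho n :
  (forall k, (n <= k)%N -> rho k.+1 = P (owner (rho k)) (mkseq rho k.+1)) ->
  outcome owner (Defs.shift P (mkseq rho n.+1)) (rho n) = Defs.suffix rho n.
Proof.
move=> h; rewrite -[in rho n](addn0 n) -[rho (n + 0)]/(Defs.suffix rho n 0).
apply: outcome_unique => k; rewrite shift_mkseq /Defs.suffix mkseq_cat.
by rewrite addnS; apply: h; exact: leq_addr.
Qed.

Lemma outcome_play i sig si v : prof_minus_from E owner i v sig -> strat_from E owner i v si ->
  is_play E (outcome owner (upd sig i si) v).
Proof.
move=> hs hi; set P := upd sig i si.
have sP j : strat_from E owner j v (P j).
  by rewrite /P /upd; case: eqVneq => [->|/hs].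
have hh n : exists t, ohist owner P v n = v :: t /\ path E v t.
  elim: n => [|n [t [e pt]]]; first by exists [::].
  rewrite /= e; exists (rcons t (P (owner (last v t)) (v :: t))); split=> //.
  by rewrite rcons_path pt sP.
move=> n; rewrite outcomeS -ohist_mkseq; have [t [e pt]] := hh n.
have -> : outcome owner P v n = last v t by rewrite /outcome e.
by rewrite e; exact: sP.
Qed.

End Outcome.

(** * From a rational profile to a Prover strategy *)

Section ProverOfProfile.
Variables (R : realType) (Pi V : finType) (E : rel V) (owner : V -> Pi).
Variables (mu : (nat -> V) -> Pi -> R) (lam : requirement R V) (i : Pi) (v0 : V).
Hypothesis hE : forall v : V, exists w : V, E v w.
Local Notation s0 := (PState v0 [set v0]%SET).
Local Notation edge := (conc_edge E owner i).

Definition vhist (h : seq (cstate V)) : seq V :=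
  [seq cvertex s | s <- h & is_prover s].

Definition prover_of (P : profile Pi V) : cstrategy V := fun h =>
  if last s0 h is PState v M then CState v (P (owner v) (vhist h)) M else s0.

Lemma vhist_path t : path edge s0 t -> exists t',
  [/\ vhist (s0 :: t) = v0 :: t', path E v0 t', last v0 t' = cvertex (last s0 t) &
      if last s0 t is CState u v M then E u v else true].
Proof.
elim/last_ind: t => [|t s IH] pt; first by exists [::].
move: pt; rewrite rcons_path => /andP[/IH[t' [e pt' l c]] es].
rewrite last_rcons; have -> : vhist (s0 :: rcons t s) =
    vhist (s0 :: t) ++ vhist [:: s].
  by rewrite -rcons_cons -cats1 /vhist filter_cat map_cat.
rewrite {}e; move: l c es; case: (last s0 t) => [v M|u v M] /= l c; case: s => //=.
  move=> v' w M' /and3P[/eqP -> ew _]; exists t'; rewrite cats0; split=> //.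
move=> w M' es; exists (rcons t' w); rewrite -cats1; split=> //; last by rewrite cats1 last_rcons.
rewrite cat_path pt' /= l andbT.
by case/orP: es => [/andP[/eqP -> _]|/and4P[_ -> _ _]].
Qed.

Variables (sig : profile Pi V) (si : strategy V).
Hypotheses (hsig : prof_minus_from E owner i v0 sig) (hsi : strat_from E owner i v0 si).
Local Notation P := (upd sig i si).

Lemma prover_of_strat : prover_strat E owner i s0 (prover_of P).
Proof.
move=> t pt; have [t' [e pt' l _]] := vhist_path pt.
rewrite /prover_of /= e; move: l; case: (last s0 t) => // v M /= l _; rewrite !eqxx andbT /=.
rewrite -l /upd; case: eqVneq => [e'|ni]; first exact: hsi.
exact: (hsig ni).
Qed.

(** Deviations are legal only at vertices of [i], so at all other vertices the proposal taken from
    [sig] is carried out. *)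
Lemma prover_of_play tauC : challenger_strat E owner i s0 tauC ->
  let z := coutcome (prover_of P) tauC s0 in let rho := projection z in
  [/\ rho 0 = v0, is_play E rho, compatible_play owner i sig rho &
    forall n, ~~ is_deviation (z (2 * n).+1) (z (2 * n).+2) ->
      rho n.+1 = P (owner (rho n)) (mkseq rho n.+1)].
Proof.
move=> hC z rho; have s0P : is_prover s0 by [].
have hP := prover_of_strat.
have ch n : chist (prover_of P) tauC s0 n = mkseq z n.+1.
  by elim: n => // n IH; rewrite mkseqS -IH /z /coutcome /= last_rcons.
have pn n : is_prover (z n) = ~~ odd n := coutcome_prover hE s0P n hP hC.
have vh k : vhist (mkseq z (2 * k).+1) = mkseq rho k.+1.
  elim: k => // k IH; have -> : (2 * k.+1).+1 = (2 * k).+3 by rewrite mulnS.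
  rewrite (mkseqS z (2 * k).+2) (mkseqS z (2 * k).+1) (mkseqS rho k.+1) -IH.
  rewrite /vhist !filter_rcons !pn oddS oddS mul2n odd_double /negb map_rcons.
  by rewrite /rho /projection mulnS mul2n.
have st n : exists M M', [/\ z (2 * n)%N = PState (rho n) M,
    z (2 * n).+1 = CState (rho n) (P (owner (rho n)) (mkseq rho n.+1)) M &
    z (2 * n).+2 = PState (rho n.+1) M'].
  have p0 : is_prover (z (2 * n)%N) by rewrite pn mul2n odd_double.
  have p2 : is_prover (z (2 * n).+2) by rewrite pn oddS oddS mul2n odd_double.
  have -> : rho n.+1 = cvertex (z (2 * n).+2) by rewrite /rho /projection mulnS.
  move: p0 p2; case: (z (2 * n).+2) => // w M' + _.
  case e : (z (2 * n)%N) => [v M|//] _; exists M, M'.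
  have er : rho n = v by rewrite /rho /projection e.
  rewrite er; split=> //; rewrite {1}/z /coutcome /= ch last_mkseq e /= last_rcons.
  by rewrite /prover_of last_mkseq e vh.
have ed n : edge (z n) (z n.+1) := coutcome_path hE n hP hC.
split=> //; first exact: (projection_play hE s0P hP hC).
- move=> n ni; have [M [M' [e1 e2 e3]]] := st n.
  have := ed (2 * n).+1; rewrite e2 e3 /= (negbTE ni) orbF => /andP[/eqP -> _].
  by rewrite /upd (negbTE ni).
- move=> n; have [M [M' [e1 e2 e3]]] := st n.
  by rewrite e2 e3 /= negbK => /eqP.
Qed.

Local Open Scope ereal_scope.

Lemma prover_of_val tauC : challenger_strat E owner i s0 tauC ->
  (forall hu, history_from E v0 hu -> compatible owner i sig v0 hu ->
      lconsistent owner mu lam (outcome owner (Defs.shift P hu) (last v0 hu))) ->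
  nuC owner mu lam i (coutcome (prover_of P) tauC s0) <= best_resp_val E owner mu i v0 sig.
Proof.
move=> hC hcons; have [r0 pr cr dr] := prover_of_play hC.
set z := coutcome _ _ _ in r0 pr cr dr *; set rho := projection z in r0 pr cr dr *.
rewrite /nuC; case: pselect => [[n [nd nc]]|_] /=; last first.
  (* The projection is compatible with the coalition, so player [i] can produce exactly this
     play. *)
  apply: ereal_sup_ubound; exists (follow_play rho si).
    by rewrite -r0; apply: follow_play_strat; rewrite // r0.
  by rewrite -r0 outcome_follow_play.
(* From [n] on every proposal is accepted, so the suffix is an outcome of the profile after a
   compatible history, and rationality makes it consistent. *)
exfalso; apply: nc; rewrite -/rho -(@outcome_shift _ _ owner P); last first.
  by move=> k nk; apply: dr; apply: nd; lia.
rewrite -(last_mkseq v0 rho n); apply: hcons; rewrite -r0.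
  exact: history_mkseq.
exact: compatible_mkseq.
Qed.

End ProverOfProfile.

(** * From a Prover strategy of value below [+oo] to a rational profile *)

Section ProfileOfProver.
Variables (R : realType) (Pi V : finType) (E : rel V) (owner : V -> Pi).
Variables (mu : (nat -> V) -> Pi -> R) (lam : requirement R V) (i : Pi) (v0 : V).
Hypothesis hE : forall v : V, exists w : V, E v w.
Local Notation s0 := (PState v0 [set v0]%SET).
Local Notation edge := (conc_edge E owner i).
Variable tauP : cstrategy V.
Hypothesis hP : prover_strat E owner i s0 tauP.

Definition proposal (c : cstate V) : V :=
  match c with PState v _ => v | CState _ v _ => v end.

Definition answer (c : cstate V) (w : V) : cstate V :=
  if c is CState u v M then if w == v then PState w (v |: M)%SET else PState w [set w]%SET
  else c.

Definition chist_of (h : seq V) : seq (cstate V) :=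
  foldl (fun H w => rcons (rcons H (tauP H)) (answer (tauP H) w)) [:: s0] (behead h).

Lemma chist_of_rcons h w : h != [::] -> chist_of (rcons h w) =
  rcons (rcons (chist_of h) (tauP (chist_of h))) (answer (tauP (chist_of h)) w).
Proof. by case: h => // v t _; rewrite /chist_of /= foldl_rcons. Qed.

(* The fallback only serves histories that are incompatible with the profile itself. *)
Definition strat_of : strategy V := fun h =>
  let w := proposal (tauP (chist_of h)) in
  if E (last v0 h) w then w else projT1 (cid (hE (last v0 h))).

(** All players share the proposals of Prover, so [strat_of] also serves as the witness for player
    [i] in rationality. *)
Definition profile_of : profile Pi V := fun=> strat_of.

Lemma strat_of_edge h : E (last v0 h) (strat_of h).
Proof.
rewrite /strat_of; case: ifP => // _; exact: (projT2 (cid (hE (last v0 h)))).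
Qed.

Lemma strat_of_from j : strat_from E owner j v0 strat_of.
Proof. by move=> t pt _; exact: (strat_of_edge (v0 :: t)). Qed.

(** When Challenger moves after [n.+1] proposals the history has [2 * n + 2] states, so half its
    size is the index of the next vertex. If steering towards [rho] is illegal, the proposal is
    accepted. *)
Definition challenger_of (rho : nat -> V) : cstrategy V := fun h =>
  let s := answer (last s0 h) (rho (size h)./2) in
  if edge (last s0 h) s then s else answer (last s0 h) (proposal (last s0 h)).

Lemma challenger_of_strat rho : challenger_strat E owner i s0 (challenger_of rho).
Proof.
move=> t pt np; rewrite /challenger_of /=; case: ifP => // _.
by move: np; case: (last s0 t) => // u v M _ /=; rewrite !eqxx.
Qed.

Lemma challenger_of_play rho : rho 0 = v0 -> is_play E rho ->
  compatible_play owner i profile_of rho ->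
  let z := coutcome tauP (challenger_of rho) s0 in
  projection z = rho /\
  (forall n, (forall k, (n <= k)%N -> rho k.+1 = strat_of (mkseq rho k.+1)) ->
     forall k, (2 * n <= k)%N -> ~~ is_deviation (z k) (z k.+1)).
Proof.
move=> r0 pr cr z.
have ch n : chist tauP (challenger_of rho) s0 n = mkseq z n.+1.
  by elim: n => // n IH; rewrite mkseqS -IH /z /coutcome /= last_rcons.
have zS n : z n.+1 = (if is_prover (z n) then tauP else challenger_of rho) (mkseq z n.+1).
  by rewrite {1}/z /coutcome /= last_rcons ch last_mkseq; case: ifP.
(* The concrete history stays equal to the replay of the vertex history, so [strat_of] reads off the
   actual proposal. *)
pose inv n M := [/\ mkseq z (2 * n).+1 = chist_of (mkseq rho n.+1),
    path edge s0 (behead (mkseq z (2 * n).+1)) & z (2 * n)%N = PState (rho n) M].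
have step n M : inv n M -> let c := CState (rho n) (strat_of (mkseq rho n.+1)) M in
    [/\ z (2 * n).+1 = c, z (2 * n).+2 = answer c (rho n.+1),
        edge (PState (rho n) M) c & edge c (answer c (rho n.+1))].
  move=> [e pth zn] c.
  have lz : last s0 (behead (mkseq z (2 * n).+1)) = PState (rho n) M.
    by rewrite -[RHS]zn -(last_mkseq s0 z (2 * n)).
  have := hP pth; rewrite lz => /(_ isT).
  have -> : s0 :: behead (mkseq z (2 * n).+1) = mkseq z (2 * n).+1 by [].
  case et : (tauP _) => [//|u w M1] /and3P[/eqP eu Ew /eqP eM].
  rewrite {}eu {}eM in et.
  have ew : strat_of (mkseq rho n.+1) = w.
    by rewrite /strat_of -e et last_mkseq /= Ew.
  have ec : c = CState (rho n) w M by rewrite /c ew.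
  have z1 : z (2 * n).+1 = c by rewrite zS zn /= et ec.
  (* A departure from the proposal can only occur at a vertex of [i], as [rho] is compatible with
     [profile_of]; hence it is a legal deviation. *)
  have edge2 : edge c (answer c (rho n.+1)).
    rewrite ec /=; case: ifP => [/eqP ->|nw] /=; first by rewrite !eqxx.
    rewrite nw pr eqxx /= !andbT; apply: contraFT nw => /cr ->.
    by rewrite /profile_of ew.
  split=> //; last by rewrite ec /= !eqxx Ew.
  rewrite zS z1 /= /challenger_of last_mkseq z1 size_mkseq.
  have -> : ((2 * n).+2)./2 = n.+1 by rewrite mul2n /= doubleK.
  by rewrite edge2.
have invS n M : inv n M -> exists M', inv n.+1 M'.
  move=> hn; have [z1 z2 ed1 ed2] := step n M hn; have [e pth zn] := hn.
  have [M' eM'] : exists M', z (2 * n).+2 = PState (rho n.+1) M'.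
    by rewrite z2 /=; case: ifP => _; eexists.
  have e3 : (2 * n.+1)%N = (2 * n).+2 by rewrite mulnS.
  exists M'; rewrite /inv e3; split=> //.
    rewrite (mkseqS z (2 * n).+2) (mkseqS z (2 * n).+1) (mkseqS rho n.+1).
    have et : tauP (chist_of (mkseq rho n.+1)) = z (2 * n).+1 by rewrite zS zn /= e.
    by rewrite chist_of_rcons // et -e z2 z1.
  rewrite (mkseqS z (2 * n).+2) (mkseqS z (2 * n).+1).
  have lz : last s0 (behead (mkseq z (2 * n).+1)) = PState (rho n) M.
    by rewrite -[RHS]zn -(last_mkseq s0 z (2 * n)).
  have -> : behead (rcons (rcons (mkseq z (2 * n).+1) (z (2 * n).+1)) (z (2 * n).+2)) =
    rcons (rcons (behead (mkseq z (2 * n).+1)) (z (2 * n).+1)) (z (2 * n).+2) by [].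
  by rewrite !rcons_path pth last_rcons lz z2 z1 ed1 ed2.
have hinv n : exists M, inv n M.
  elim: n => [|n [M]]; last exact: invS.
  by exists [set v0]%SET; rewrite /inv r0.
split.
  by apply/funext => n; have [M [_ _ zn]] := hinv n; rewrite /projection zn.
move=> n hr k nk; case: (boolP (odd k)) => ok.
  have ek : k = (2 * k./2).+1 by rewrite -{1}(odd_double_half k) ok mul2n.
  have [M /step[z1 z2 _ _]] := hinv k./2.
  rewrite ek z1 z2 -hr /=; last by lia.
  by rewrite eqxx /= eqxx.
have ek : k = (2 * k./2)%N by rewrite -{1}(odd_double_half k) (negbTE ok) mul2n.
by have [M [_ _ zn]] := hinv k./2; rewrite ek zn.
Qed.

Local Open Scope ereal_scope.
Variable a : \bar R.
Hypotheses (a_fin : a < +oo) (ha : forall tauC, challenger_strat E owner i s0 tauC ->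
  nuC owner mu lam i (coutcome tauP tauC s0) <= a).

(** Let Challenger steer along [rho]. Since [a < +oo], the infinite penalty is excluded, which gives
    the payoff bound and the consistency of suffixes without deviation. *)
Lemma profile_of_play (rho : nat -> V) : rho 0%N = v0 -> is_play E rho ->
  compatible_play owner i profile_of rho ->
  (mu rho i)%:E <= a /\
  (forall n, (forall k, (n <= k)%N -> rho k.+1 = strat_of (mkseq rho k.+1)) ->
     lconsistent owner mu lam (Defs.suffix rho n)).
Proof.
move=> r0 pr cr; have [er hd] := challenger_of_play r0 pr cr.
have := ha (challenger_of_strat rho); rewrite /nuC er; case: pselect => [_|h] /= le.
  by move: a_fin; rewrite ltNge le.
split=> // n hn; apply: contrapT => nc; apply: h; exists n; split=> //.
exact: hd.
Qed.

Lemma profile_of_rat : lRat E owner mu lam i v0 profile_of.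
Proof.
split=> [j _|]; first exact: strat_of_from.
exists strat_of; split=> [|hu [t [-> pt]] cmp]; first exact: strat_of_from.
have eP : upd profile_of i strat_of = profile_of.
  by apply/funext => j; rewrite /upd; case: ifP.
rewrite {}eP; set Q := Defs.shift _ _; set w := outcome owner Q _.
pose n := size t.
(* The history and the outcome after it are glued at index [n], their common vertex, into one play
   whose suffix is [w]. *)
pose rho k := if (k < n)%N then nth v0 (v0 :: t) k else w (k - n)%N.
have w0 : w 0%N = last v0 t by [].
have rhoE k : (k <= n)%N -> rho k = nth v0 (v0 :: t) k.
  rewrite /rho leq_eqVlt => /orP[/eqP ->|->//]; rewrite ltnn subnn w0.
  by rewrite -[n]/(size (v0 :: t)).-1 nth_last.
have rhow k : rho (n + k)%N = w k by rewrite /rho ltnNge leq_addr /= addKn.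
have hist : mkseq rho n.+1 = v0 :: t.
  apply: (@eq_from_nth _ v0); rewrite size_mkseq // => k kn.
  by rewrite nth_mkseq // rhoE.
have step k : (n <= k)%N -> rho k.+1 = strat_of (mkseq rho k.+1).
  move=> nk; rewrite -(subnKC nk) -addnS rhow /w outcomeS -/w /Q -hist shift_mkseq.
  by rewrite -mkseq_cat; congr (strat_of (_ ++ _)); apply: eq_mkseq => l; rewrite rhow.
have pr : is_play E rho.
  move=> k; case: (ltnP k n) => kn; last first.
    by rewrite step // -[X in E X](last_mkseq v0 rho k); exact: strat_of_edge.
  by rewrite !rhoE // ?(ltnW kn) //; have /(pathP v0)/(_ k kn) := pt.
have cr : compatible_play owner i profile_of rho.
  move=> k; case: (ltnP k n) => kn; last by move=> _; exact: step.
  rewrite !rhoE // ?(ltnW kn) // => /(cmp k kn) ->; congr strat_of.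
  by rewrite -hist take_mkseq // ltnW.
have r0 : rho 0%N = v0 by rewrite rhoE.
have [_ h] := profile_of_play r0 pr cr.
have -> : w = Defs.suffix rho n by apply/funext => k; rewrite /Defs.suffix rhow.
exact: h step.
Qed.

Lemma profile_of_resp : best_resp_val E owner mu i v0 profile_of <= a.
Proof.
apply: ge_ereal_sup => _ [si hsi <-].
set rho := outcome _ _ _.
have [] // := @profile_of_play rho.
  apply: outcome_play => // j _; exact: strat_of_from.
by move=> n ni; rewrite /rho outcomeS -/rho /upd (negbTE ni).
Qed.

End ProfileOfProver.

(** * Equality with the negotiation function, and steady negotiation *)

Local Open Scope ereal_scope.

Theorem mainTheorem7 (Pi V : finType) (E : rel V)
  (hE : forall v : V, exists w : V, E v w)
  (owner : V -> Pi) (mu : (nat -> V) -> Pi -> Rdefinitions.R)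
  (hBorel : borel_payoff mu) (hPI : prefix_independent E mu) :
  (forall (lam : requirement Rdefinitions.R V) (i : Pi) (v0 : V), owner v0 = i ->
     conc_lower_val E owner mu lam i (PState v0 [set v0]%SET)
       = nego E owner mu lam i v0 /\
     conc_upper_val E owner mu lam i (PState v0 [set v0]%SET)
       = nego E owner mu lam i v0)
  /\
  ((forall (i : Pi) (v0 : V), owner v0 = i ->
      forall lam : requirement Rdefinitions.R V,
        exists tauP, prover_optimal E owner mu lam i (PState v0 [set v0]%SET) tauP) ->
   steady_negotiation E owner mu).
Proof.
have upper lam i v0 : conc_upper_val E owner mu lam i (PState v0 [set v0]%SET)
    = nego E owner mu lam i v0.
  apply/eqP; rewrite eq_le; apply/andP; split.
    apply: le_ereal_inf_tmp => _ [sig [hsig [si [hsi hc]]] <-].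
    apply: ge_ereal_inf; exists (ereal_sup [set nuC owner mu lam i
        (coutcome (prover_of owner v0 (upd sig i si)) tauC (PState v0 [set v0]%SET))
        | tauC in challenger_strat E owner i (PState v0 [set v0]%SET)]).
      exists (prover_of owner v0 (upd sig i si)) => //.
      exact: prover_of_strat.
    by apply: ge_ereal_sup => _ [tauC hC <-]; exact: prover_of_val.
  apply: le_ereal_inf_tmp => _ [tauP hP <-]; set a := ereal_sup _.
  (* Prover strategies of value [+oo] give no profile, but bound nothing either. *)
  have [->|fin] := eqVneq a +oo; first exact: leey.
  have {}fin : a < +oo by rewrite lt_neqAle fin leey.
  have ha tauC : challenger_strat E owner i (PState v0 [set v0]%SET) tauC ->
      nuC owner mu lam i (coutcome tauP tauC (PState v0 [set v0]%SET)) <= a.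
    by move=> hC; apply: ereal_sup_ubound; exists tauC.
  apply: ge_ereal_inf; exists (best_resp_val E owner mu i v0 (profile_of v0 hE tauP)).
    by exists (profile_of v0 hE tauP) => //; exact: (profile_of_rat hE hP fin ha).
  exact: (profile_of_resp hE hP fin ha).
split=> [lam i v0 _|opt lam i v ov [sig0 rat0]].
  by rewrite (conc_value owner hE hBorel hPI).
have lower sig : lRat E owner mu lam i v sig ->
    nego E owner mu lam i v <= best_resp_val E owner mu i v sig.
  by move=> rs; apply: ereal_inf_lbound; exists sig.
(* If the infimum is [+oo], the given rational profile attains it; otherwise the profile of an
   optimal Prover strategy is rational and does. *)
have [inf|fin] := eqVneq (nego E owner mu lam i v) +oo.
  exists sig0 => //; apply/eqP; rewrite eq_le lower // inf leey //.
have [tauP [hP ha]] := opt i v ov lam.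
have {}fin : nego E owner mu lam i v < +oo by rewrite lt_neqAle fin leey.
have hn tauC : challenger_strat E owner i (PState v [set v]%SET) tauC ->
    nuC owner mu lam i (coutcome tauP tauC (PState v [set v]%SET)) <= nego E owner mu lam i v.
  by move=> hC; rewrite -upper -ha; apply: ereal_sup_ubound; exists tauC.
have rat := profile_of_rat hE hP fin hn.
exists (profile_of v hE tauP) => //; apply/eqP; rewrite eq_le lower // andbT.
exact: (profile_of_resp hE hP fin hn).
Qed.
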